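(* Let $d\ge 1$ and let $W:\mathbb{R}^d\to\mathbb{R}\cup\{+\infty\}$ be lower semicontinuous, bounded from below by a finite constant, locally integrable and symmetric ($W(-x)=W(x)$ for all $x$). Suppose that the limit $W_\infty:=\lim_{|x|\to\infty}W(x)$ exists in $\mathbb{R}\cup\{+\infty\}$, that there is $R_W>0$ such that $W$ is radially strictly increasing on $\mathbb{R}^d\setminus B_{R_W}$, and that one of the following two properties holds: (A) $W$ is bounded from above and upper semicontinuous; (B) $W$ is $\beta$-repulsive for some $2<\beta<d$, $W\in C^1(\mathbb{R}^d\setminus\{0\})$, and there is $C_W>0$ such that $\Delta^0W(x)\le C_W$ for all $x\in\mathbb{R}^d$, $W(x)\le C_W|x|^{2-\beta}$ for all $|x|\le 1$, and $|\nabla W(x)|\le C_W|x|^{1-\beta}$ for all $0<|x|\le 1$. Suppose moreover that $W$ is discretely unstable. Then there is a constant $K>0$ depending only on $W$ (in particular independent of $N$) such that for every $N\ge2$ the diameter of any minimiser of $E_N$ on $\mathbb{R}^{Nd}$ is less than $K$.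
   Context: $B_R$ is the open ball of radius $R$ centred at $0$ in $\mathbb{R}^d$. ''Radially strictly increasing on $\mathbb{R}^d\setminus B_{R_W}$'' means $W(x)<W(y)$ whenever $R_W\le|x|<|y|$. For $N\ge2$ and $\boldsymbol{X}=(x_1,\dots,x_N)\in\mathbb{R}^{Nd}$, $E_N(\boldsymbol{X})=\frac{1}{2N^2}\sum_{i=1}^N\sum_{j\ne i}W(x_i-x_j)$; minimisers are global; the diameter of $\boldsymbol{X}$ is that of the set $\{x_1,\dots,x_N\}$. $W$ is discretely unstable if there exist $s>0$ and $\bar N\ge2$ such that for all $N>\bar N$ there exists $\boldsymbol{X}\in\mathbb{R}^{Nd}$ with $E_N(\boldsymbol{X})<\frac12W_\infty-s$. Generalised Laplacian: $\Delta^\varepsilon W(x)=\frac{2(d+2)}{\varepsilon^2}\left(\frac{1}{|B_\varepsilon|}\int_{B_\varepsilon}W(x+y)\,dy-W(x)\right)$ for $\varepsilon>0$ (equal to $-\infty$ if $W(x)=+\infty$), and $\Delta^0W(x)=\liminf_{\varepsilon\to0}\Delta^\varepsilon W(x)\in[-\infty,+\infty]$. $W$ is $\beta$-repulsive if it is locally integrable and there exist $\delta>0$, $C>0$ with $-\Delta^0W(x)\ge C|x|^{-\beta}$ for all $0<|x|<\delta$ and $-\Delta^0W(0)=+\infty$. In (B), $|0|^{2-\beta}=+\infty$. *)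

(* Defs.v *)
From HB Require Import structures.
From mathcomp Require Import all_boot all_order all_algebra.
From mathcomp Require Import all_classical all_reals all_analysis.
From mathcomp Require Import measurable_realfun.
Set Implicit Arguments.
Unset Strict Implicit.
Unset Printing Implicit Defensive.
Import Order.TTheory GRing.Theory Num.Theory.
Import numFieldNormedType.Exports.
Local Open Scope classical_set_scope.
Local Open Scope ring_scope.

Definition measure_rV_display : measure_display.
Proof. exact: default_measure_display. Qed.

Section measurable_rV.
Context {R : realType} (n : nat).

Definition rVcoor (i : 'I_n) (x : 'rV[R]_n) : measurableTypeR R := x ord0 i.

Let rV_set0 : g_sigma_preimage rVcoor set0.
Proof. exact: sigma_algebra0. Qed.

Let rV_setC A : g_sigma_preimage rVcoor A -> g_sigma_preimage rVcoor (~` A).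
Proof. exact: sigma_algebraC. Qed.

Let rV_bigcup (F : _^nat) : (forall i, g_sigma_preimage rVcoor (F i)) ->
  g_sigma_preimage rVcoor (\bigcup_i (F i)).
Proof. exact: sigma_algebra_bigcup. Qed.

(* The product sigma-algebra on R^n; it is the Borel one since R is second
   countable. *)
HB.instance Definition _ := @isMeasurable.Build measure_rV_display
  'rV[R]_n (g_sigma_preimage rVcoor) rV_set0 rV_setC rV_bigcup.

Lemma measurable_rVcoor i : measurable_fun [set: 'rV[R]_n] (rVcoor i).
Proof.
move=> _ Y mY; rewrite setTI; apply: sub_sigma_algebra => /=.
rewrite -bigcup_seq/=; exists i => /=; first by rewrite mem_index_enum.
by exists Y => //; rewrite setTI.
Qed.

Lemma measurable_fun_rVcoorP d (T : measurableType d) (f : T -> 'rV[R]_n) :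
  (forall i, measurable_fun [set: T] (rVcoor i \o f)) ->
  measurable_fun [set: T] f.
Proof.
move=> mf; have : g_sigma_preimage (fun i => rVcoor i \o f) `<=` measurable.
  apply: smallest_sub; first exact: sigma_algebra_measurable.
  rewrite -bigcup_seq; apply: bigcup_sub => i _.
  by move=> A [B mB <-]; exact: mf.
rewrite g_sigma_preimage_comp => prefS.
by move=> _ A mA; apply: prefS; exists A.
Qed.

End measurable_rV.

Section lebesgue_rV.
Context {R : realType}.
Local Open Scope ereal_scope.

(* Lebesgue measure on R^n.+1 is the image of the product of those on R and R^n
   under the concatenation map (a, x) |-> (a, x_0, ..., x_{n-1}). *)
Definition rVcons n (p : measurableTypeR R * 'rV[R]_n) : 'rV[R]_n.+1 :=
  \row_(i < n.+1) if unlift ord0 i is Some j then p.2 ord0 j else p.1.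

Lemma measurable_rVcons n : measurable_fun setT (@rVcons n).
Proof.
apply: measurable_fun_rVcoorP => i.
case: (unliftP ord0 i) => [j|] ->.
- rewrite (_ : _ \o _ = @rVcoor R n j \o snd); last first.
    by apply/funext => p; rewrite /rVcoor /= mxE liftK.
  apply: measurableT_comp => //; exact: measurable_rVcoor.
- rewrite (_ : _ \o _ = fst); last first.
    by apply/funext => p; rewrite /rVcoor /= mxE unlift_none.
  exact: measurable_fst.
Qed.

Definition rVuncons n (x : 'rV[R]_n.+1) : measurableTypeR R * 'rV[R]_n :=
  (x ord0 ord0, \row_j x ord0 (lift ord0 j)).

Lemma rVconsK n : cancel (@rVcons n) (@rVuncons n).
Proof.
move=> [a x]; rewrite /rVuncons mxE unlift_none; congr pair.
by apply/rowP => j; rewrite !mxE liftK.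
Qed.

Lemma measurable_rVuncons n : measurable_fun setT (@rVuncons n).
Proof.
apply/measurable_fun_pairP; split.
  exact: (@measurable_rVcoor R n.+1 ord0).
apply: measurable_fun_rVcoorP => j.
rewrite (_ : _ \o _ = rVcoor (lift ord0 j)); first exact: measurable_rVcoor.
by apply/funext => x; rewrite /rVcoor /= mxE.
Qed.

Definition lebesgue_rVS n (m : {sigma_finite_measure set 'rV[R]_n -> \bar R}) :
  set 'rV[R]_n.+1 -> \bar R :=
  pushforward ((@lebesgue_measure R) \x m) (@rVcons n).

Section lebesgue_rVS.
Variables (n : nat) (m : {sigma_finite_measure set 'rV[R]_n -> \bar R}).

Let lebesgue_rVS0 : lebesgue_rVS m set0 = 0.
Proof. by rewrite /lebesgue_rVS /pushforward preimage_set0 measure0. Qed.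

Let lebesgue_rVS_ge0 A : 0 <= lebesgue_rVS m A.
Proof. by rewrite /lebesgue_rVS /pushforward measure_ge0. Qed.

Let lebesgue_rVS_sigma_additive : semi_sigma_additive (lebesgue_rVS m).
Proof.
have mc := @measurable_rVcons n.
move=> F mF tF mUF; rewrite /lebesgue_rVS /pushforward preimage_bigcup.
apply: measure_semi_sigma_additive.
- by move=> i; rewrite -[X in measurable X]setTI; exact: mc.
- apply/trivIsetP => /= i j _ _ ij; rewrite -preimage_setI.
  by move/trivIsetP : tF => /(_ _ _ _ _ ij) ->//; rewrite preimage_set0.
- by rewrite -preimage_bigcup -[X in measurable X]setTI; exact: mc.
Qed.

HB.instance Definition _ := isMeasure.Build _ _ _
  (lebesgue_rVS m) lebesgue_rVS0 lebesgue_rVS_ge0 lebesgue_rVS_sigma_additive.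

Let lebesgue_rVS_sigma_finite : sigma_finite setT (lebesgue_rVS m).
Proof.
have /sigma_finiteP[F [TF ndF Foo]] := sigma_finiteT (@lebesgue_measure R).
have /sigma_finiteP[G [TG ndG Goo]] := sigma_finiteT m.
exists (fun k => @rVuncons n @^-1` (F k `*` G k)).
  rewrite -preimage_bigcup (_ : \bigcup_k _ = setT) ?preimage_setT//.
  rewrite -setXTT TF TG predeqE => -[x y]; split.
    by move=> [k _ []/= ? ?]; split; exists k.
  move=> [/= [i _ Fix] [k _ Gky]]; exists (maxn i k) => //; split.
  - by move: x Fix; exact/subsetPset/ndF/leq_maxl.
  - by move: y Gky; exact/subsetPset/ndG/leq_maxr.
move=> k; have [mF Fk] := Foo k; have [mG Gk] := Goo k; split.
  rewrite -[X in measurable X]setTI; apply: measurable_rVuncons => //.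
  exact: measurableX.
rewrite /lebesgue_rVS /pushforward -comp_preimage.
rewrite (_ : _ \o _ = idfun); last by apply/funext => p; exact: rVconsK.
by rewrite preimage_id product_measure1E// lte_mul_pinfty// ge0_fin_numE.
Qed.

HB.instance Definition _ := @Measure_isSigmaFinite.Build _ _ _
  (lebesgue_rVS m) lebesgue_rVS_sigma_finite.

End lebesgue_rVS.

Fixpoint lebesgue_rV n : {sigma_finite_measure set 'rV[R]_n -> \bar R} :=
  if n is k.+1 then lebesgue_rVS (lebesgue_rV k) else dirac (0%R : 'rV[R]_0).

Lemma measurable_rV_box n (A : 'I_n -> set (measurableTypeR R)) :
  (forall i, measurable (A i)) ->
  measurable [set x : 'rV[R]_n | forall i, A i (x ord0 i)].
Proof.
move=> mA.
rewrite (_ : mkset _ = \big[setI/setT]_(i < n) (@rVcoor R n i @^-1` A i)).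
  apply: bigsetI_measurable => i _; rewrite -[X in measurable X]setTI.
  exact: measurable_rVcoor.
rewrite -bigcap_seq; apply/seteqP; split => x /= xA i; first by move=> _; exact: xA.
by apply: (xA i); rewrite /= mem_index_enum.
Qed.

Lemma lebesgue_rV_box n (A : 'I_n -> set (measurableTypeR R)) :
  (forall i, measurable (A i)) ->
  lebesgue_rV n [set x | forall i, A i (x ord0 i)] =
  \prod_(i < n) lebesgue_measure (A i).
Proof.
elim: n A => [|n IH] A mA /=.
  by rewrite big_ord0 diracE mem_set//; case.
rewrite /lebesgue_rVS /pushforward big_ord_recl -IH//.
rewrite -product_measure1E//; last first.
  exact: (@measurable_rV_box n (fun i => A (lift ord0 i))).
congr (_ _); apply/seteqP; split => [[a x]/= xA|[a x] /= [aA xA] i].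
  split=> [|i].
    by have := xA ord0; rewrite mxE unlift_none.
  by have := xA (lift ord0 i); rewrite mxE liftK.
by rewrite mxE; case: unliftP => [j|] ->.
Qed.

End lebesgue_rV.

Section interaction.
Context {R : realType} {d : nat}.
Local Open Scope ereal_scope.
Implicit Types (W : 'rV[R]_d -> \bar R) (x y : 'rV[R]_d).

Local Notation mu := (@lebesgue_rV R d).

(* The Euclidean norm: the library norm on 'rV[R]_d is the sup norm, which
   defines the same topology. *)
Definition enorm x : R := Num.sqrt (\sum_i x ord0 i ^+ 2)%R.

Definition eball (r : R) : set 'rV[R]_d := [set x | (enorm x < r)%R].

(* The filter of neighbourhoods of infinity, i.e. |x| --> +oo. *)
Definition enorm_infty : set_system 'rV[R]_d :=
  filter_from setT (fun M : R => [set x | (M < enorm x)%R]).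

(* The dual of the library's [lower_semicontinuous]. *)
Definition upper_semicontinuous W := forall x a, W x < a%:E ->
  exists2 V, nbhs x V & forall y, V y -> W y < a%:E.

(* The library's [locally_integrable] is restricted to functions R -> R. *)
Definition loc_integrable W := measurable_fun setT W /\
  forall K : set 'rV[R]_d, compact K -> \int[mu]_(x in K) `|W x| < +oo.

Definition radially_increasing_outside W (r : R) :=
  forall x y, (r <= enorm x)%R -> (enorm x < enorm y)%R -> W x < W y.

Definition gradient (f : 'rV[R]_d -> R) x : 'rV[R]_d :=
  \row_i 'D_(delta_mx ord0 i) f x.

Definition C1_off0 W := forall x, x != 0%R ->
  [/\ W x \is a fin_num, differentiable (fine \o W) x &
      {for x, continuous (gradient (fine \o W))}].

(* |x|^a for a < 0, with |0|^a = +oo (whereas [0 `^ a = 0] for a != 0). *)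
Definition negpow x (a : R) : \bar R :=
  if x == 0%R then +oo else (enorm x `^ a)%:E.

Definition laplacian_eps (e : R) W x : \bar R :=
  if W x == +oo then -oo else
  (2 * (d%:R + 2) / e ^+ 2)%:E *
  ((fine (mu (eball e)))^-1%:E * \int[mu]_(y in eball e) W (x + y)%R - W x).

Definition laplacian0 W x : \bar R :=
  limf_einf (fun e => laplacian_eps e W x) (0%R : R)^'+.

Definition beta_repulsive (beta : R) W := loc_integrable W /\
  exists delta C : R, [/\ (0 < delta)%R, (0 < C)%R,
    forall x, (0 < enorm x < delta)%R ->
      (C * enorm x `^ (- beta))%:E <= - laplacian0 W x &
    - laplacian0 W 0%R = +oo].

Definition energy W N (X : 'I_N -> 'rV[R]_d) : \bar R :=
  (2 * N%:R ^+ 2)^-1%:E * \sum_(i < N) \sum_(j < N | j != i) W (X i - X j)%R.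

Definition minimiser W N (X : 'I_N -> 'rV[R]_d) :=
  forall Y : 'I_N -> 'rV[R]_d, energy W X <= energy W Y.

Definition diameter (A : set 'rV[R]_d) : R :=
  sup [set enorm (x - y)%R | x in A & y in A].

Definition discretely_unstable W (Winf : \bar R) :=
  exists s : R, (0 < s)%R /\ exists Nbar : nat, (2 <= Nbar)%N /\
  forall N : nat, (Nbar < N)%N -> exists X : 'I_N -> 'rV[R]_d,
    energy W X < 2^-1%:E * Winf - s%:E.

Definition property_A W :=
  (exists M : R, forall x, W x <= M%:E) /\ upper_semicontinuous W.

Definition property_B W := exists beta : R,
  [/\ (2 < beta)%R, (beta < d%:R)%R, beta_repulsive beta W, C1_off0 W &
  exists CW : R, [/\ (0 < CW)%R,
    forall x, laplacian0 W x <= CW%:E,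
    forall x, (enorm x <= 1)%R -> W x <= CW%:E * negpow x (2 - beta) &
    forall x, (0 < enorm x <= 1)%R ->
      (enorm (gradient (fine \o W) x) <= CW * enorm x `^ (1 - beta))%R]].

End interaction.

(* Main.v *)
(* A minimiser leaves no empty slab of width [RW + 1] between two of its
   particles: translating one side towards the other would decrease the energy.
   The diameter is therefore bounded as soon as every particle has a fixed
   fraction of all particles at bounded distance, which in turn follows from a
   bound [\sum_(j != i) W (x_i - x_j) <= N A] with [A < Winf].  By minimality the
   left-hand side can only increase if [x_i] is moved elsewhere.  In case (A) it
   is moved onto a particle [x_k] whose potential is at most the mean one, which
   the instability bounds.  In case (B) it is moved to [x_k + z], where [z] of size
   [e] is such that the singular terms [|x_k - x_j + z|^(2 - beta)] are at most
   their mean over [z], of order [e^(2 - beta)].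
   - If [Winf = +oo] any finite [A] will do, and comparison with a quadratic barrier
     shows that [laplacian0 W <= CW] bounds [W (x + z)] by an affine function of
     [W x] far from the origin.
   - If [Winf] is finite the shift must cost arbitrarily little.  Comparison with
     [(|x|^2 + tau^2)^((2 - beta) / 2)] gives [W x >= c |x|^(2 - beta) - C], so that
     [\sum_j |x_k - x_j|^(2 - beta)] is of order [N], and by pigeonhole over
     geometric scales some [e] has few particles at distance about [e] from
     [x_k]. *)

Require Import Defs.
From HB Require Import structures.
From mathcomp Require Import all_boot all_order all_algebra.
From mathcomp Require Import all_classical all_reals all_analysis.
From mathcomp Require Import measurable_realfun.
From mathcomp Require Import ring lra.
Import Order.TTheory GRing.Theory Num.Theory.
Import numFieldNormedType.Exports.
Set Implicit Arguments.
Unset Strict Implicit.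
Unset Printing Implicit Defensive.
Local Open Scope classical_set_scope.
Local Open Scope ring_scope.

(** * The Euclidean norm *)

Section enorm.
Context {R : realType} {d : nat}.
Implicit Types x y z : 'rV[R]_d.

Definition dot x y : R := \sum_i x ord0 i * y ord0 i.

Lemma dotC x y : dot x y = dot y x.
Proof. by apply: eq_bigr => i _; rewrite mulrC. Qed.

Lemma dotDl x y z : dot (x + y) z = dot x z + dot y z.
Proof. by rewrite /dot -big_split; apply: eq_bigr => i _; rewrite mxE mulrDl. Qed.

Lemma dotDr x y z : dot x (y + z) = dot x y + dot x z.
Proof. by rewrite dotC dotDl !(dotC x). Qed.

Lemma dotZl a x y : dot (a *: x) y = a * dot x y.
Proof. by rewrite /dot mulr_sumr; apply: eq_bigr => i _; rewrite mxE mulrA. Qed.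

Lemma dotZr a x y : dot x (a *: y) = a * dot x y.
Proof. by rewrite dotC dotZl dotC. Qed.

Lemma dotNr x y : dot x (- y) = - dot x y.
Proof. by rewrite -scaleN1r dotZr mulN1r. Qed.

Lemma dotxx_ge0 x : 0 <= dot x x.
Proof. by apply: sumr_ge0 => i _; rewrite -expr2 sqr_ge0. Qed.

Lemma sqr_enorm x : enorm x ^+ 2 = dot x x.
Proof. by rewrite sqr_sqrtr ?dotxx_ge0 // sumr_ge0 // => i _; rewrite sqr_ge0. Qed.

Lemma dotxx x : dot x x = \sum_i x ord0 i ^+ 2.
Proof. by apply: eq_bigr => i _; rewrite expr2. Qed.

Lemma enorm_ge0 x : 0 <= enorm x.
Proof. exact: sqrtr_ge0. Qed.

Lemma enorm0 : enorm (0 : 'rV[R]_d) = 0.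
Proof. by rewrite /enorm big1 ?sqrtr0// => i _; rewrite mxE expr0n. Qed.

Lemma coord_le_enorm x i : `|x ord0 i| <= enorm x.
Proof.
rewrite -sqrtr_sqr ler_wsqrtr// (bigD1 i)//= lerDl sumr_ge0// => j _.
exact: sqr_ge0.
Qed.

Lemma enorm_eq0 x : (enorm x == 0) = (x == 0).
Proof.
apply/idP/eqP => [/eqP x0|->]; last by rewrite enorm0.
apply/rowP => i; rewrite mxE; apply/eqP; rewrite -normr_le0.
by rewrite -x0 coord_le_enorm.
Qed.

Lemma enorm_gt0 x : (0 < enorm x) = (x != 0).
Proof. by rewrite lt_def enorm_ge0 andbT enorm_eq0. Qed.

Lemma enormZ a x : enorm (a *: x) = `|a| * enorm x.
Proof.
apply/eqP; rewrite -(@eqrXn2 _ 2)// ?mulr_ge0 ?enorm_ge0//.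
by rewrite exprMn !sqr_enorm dotZl dotZr mulrA real_normK ?num_real.
Qed.

Lemma enormN x : enorm (- x) = enorm x.
Proof. by rewrite -scaleN1r enormZ normrN1 mul1r. Qed.

Lemma sqr_enormD x y :
  enorm (x + y) ^+ 2 = enorm x ^+ 2 + 2 * dot x y + enorm y ^+ 2.
Proof. by rewrite !sqr_enorm dotDl !dotDr (dotC y x); ring. Qed.

(** Cauchy-Schwarz: the left-hand side of [H z] is the squared norm of [|z|^2 x - <x, z> z], a
    multiple of the part of [x] orthogonal to [z]. *)
Lemma dot_le_enorm x y : `|dot x y| <= enorm x * enorm y.
Proof.
have H z : enorm z ^+ 2 * (enorm x ^+ 2 * enorm z ^+ 2 - dot x z ^+ 2) >= 0.
  suff -> : enorm z ^+ 2 * (enorm x ^+ 2 * enorm z ^+ 2 - dot x z ^+ 2) =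
    enorm (enorm z ^+ 2 *: x + (- dot x z) *: z) ^+ 2 by exact: sqr_ge0.
  rewrite sqr_enormD !enormZ dotZl dotZr !exprMn !real_normK ?num_real//.
  by ring.
have [->|y0] := eqVneq y 0.
  rewrite (_ : dot x 0 = 0) ?normr0 ?mulr_ge0 ?enorm_ge0//.
  by rewrite -(scale0r 0) dotZr mul0r.
have := H y; rewrite pmulr_rge0; last by rewrite exprn_gt0// enorm_gt0.
rewrite subr_ge0 -exprMn => K.
rewrite -(ger0_norm (mulr_ge0 (enorm_ge0 x) (enorm_ge0 y))).
by rewrite -(@ler_pXn2r _ 2)// ?nnegrE// !real_normK ?num_real.
Qed.

Lemma ler_enormD x y : enorm (x + y) <= enorm x + enorm y.
Proof.
rewrite -(@ler_pXn2r _ 2)// ?nnegrE ?addr_ge0 ?enorm_ge0//.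
have := le_trans (ler_norm _) (dot_le_enorm x y).
by rewrite sqr_enormD sqrrD; lra.
Qed.

Lemma enormB x y : enorm (x - y) = enorm (y - x).
Proof. by rewrite -enormN opprB. Qed.

Lemma ler_enorm_sum x : enorm x <= \sum_i `|x ord0 i|.
Proof.
rewrite -(@ler_pXn2r _ 2)// ?nnegrE ?enorm_ge0 ?sumr_ge0//.
rewrite sqr_enorm expr2 mulr_suml ler_sum// => i _.
rewrite -[leLHS]ger0_norm -?expr2 ?sqr_ge0// expr2 normrM ler_wpM2l//.
by rewrite (bigD1 i)//= lerDl sumr_ge0.
Qed.

Lemma ler_enorm_dim x r : (forall i, `|x ord0 i| <= r) -> enorm x <= d%:R * r.
Proof.
move=> xr; apply: le_trans (ler_enorm_sum x) _.
apply: le_trans (ler_sum _ (fun i _ => xr i)) _.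
by rewrite sumr_const card_ord mulr_natl.
Qed.

Lemma coord_le_norm x i : `|x ord0 i| <= `|x|.
Proof.
rewrite [leRHS]/Num.norm/= mx_normrE.
exact: (@le_bigmax _ _ _ _ (fun ij => `|x ij.1 ij.2|) (ord0, i)).
Qed.

Lemma enorm_le_norm x : enorm x <= d%:R * `|x|.
Proof. by apply: ler_enorm_dim => i; exact: coord_le_norm. Qed.

Lemma norm_le_enorm x : `|x| <= enorm x.
Proof.
rewrite [leLHS]/Num.norm/= mx_normrE.
apply/bigmax_leP; split => [|[i j] _ /=]; first exact: enorm_ge0.
by rewrite ord1 coord_le_enorm.
Qed.

Lemma ler_enorm_dist x y : `|enorm x - enorm y| <= enorm (x - y).
Proof.
have H (u v : 'rV[R]_d) : enorm u - enorm v <= enorm (u - v).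
  by rewrite lerBlDr; have := ler_enormD (u - v) v; rewrite subrK.
by rewrite ler_norml H andbT lerNl opprB enormB H.
Qed.

Lemma continuous_enorm : continuous (@enorm R d).
Proof.
move=> x; apply/(@cvgrPdist_lt _ _ _ (nbhs x) (nbhs_filter x)) => e e0.
apply/nbhs_ballP.
exists (e / d.+1%:R) => /=; first by rewrite divr_gt0.
move=> y; rewrite -ball_normE/= ltr_pdivlMr// => xy.
apply: le_lt_trans (ler_enorm_dist _ _) _.
apply: le_lt_trans (enorm_le_norm _) _.
by apply: le_lt_trans xy; rewrite mulrC ler_wpM2l// ler_nat.
Qed.

Lemma compact_sub_enorm (A : set 'rV[R]_d) (r : R) :
  closed A -> (forall x, A x -> enorm x <= r) -> compact A.
Proof.
move=> cA Ar; apply: bounded_closed_compact => //.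
exists r; split; first exact: num_real.
move=> s rs x /Ar xr; apply: le_trans (norm_le_enorm x) _.
exact: le_trans xr (ltW rs).
Qed.

Lemma closed_enorm_le (r : R) : closed [set x : 'rV[R]_d | enorm x <= r].
Proof.
apply: (@preimage_closed _ _ (@enorm R d) [set t | t <= r]).
  by move=> x _; exact: continuous_enorm.
exact: closed_le.
Qed.

Lemma closed_enorm_ge (r : R) : closed [set x : 'rV[R]_d | r <= enorm x].
Proof.
apply: (@preimage_closed _ _ (@enorm R d) [set t | r <= t]).
  by move=> x _; exact: continuous_enorm.
exact: closed_ge.
Qed.

Lemma nbhs_enorm_ball x r : 0 < r -> \forall y \near x, enorm (y - x) < r.
Proof.
move=> r0.
have := @continuous_enorm 0; rewrite /continuous_at enorm0.
move=> /cvgrPdist_lt /(_ _ r0) /nbhs_ballP[e /= e0 H].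
apply/nbhs_ballP; exists e => //= y xy.
have := H (y - x); rewrite sub0r normrN ger0_norm ?enorm_ge0//; apply.
by move: xy; rewrite -!ball_normE/= sub0r opprB.
Qed.

End enorm.

Lemma nbhs_enormP (R : realType) (d : nat) (x : 'rV[R]_d) (U : set 'rV[R]_d) :
  nbhs x U -> exists e, 0 < e /\ forall y, enorm (y - x) < e -> U y.
Proof.
move=> /nbhs_ballP[e /= e0 eU]; exists e; split=> // y yx; apply: eU.
by rewrite -ball_normE/= -normrN opprB (le_lt_trans (norm_le_enorm _)).
Qed.

(** * Shifts away from finitely many singularities *)

Lemma ler_powRn (R : realType) (r a b : R) : r <= 0 -> 0 < a -> a <= b ->
  b `^ r <= a `^ r.
Proof.
move=> r0 a0 ab; have b0 := lt_le_trans a0 ab.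
have e x : x `^ r = (x `^ (- r))^-1 by rewrite -powRN opprK.
rewrite !e lef_pV2 ?posrE ?powR_gt0//.
by apply: ge0_ler_powR; rewrite ?nnegrE; lra.
Qed.

Section one_dim_choice.
Context {R : realType}.
Variable p : R.
Hypothesis p01 : 0 < p < 1.
Implicit Types s t u h M : R.

Let p0 : 0 < p. Proof. by case/andP: p01. Qed.
Let p1 : p < 1. Proof. by case/andP: p01. Qed.

(** Young's inequality for the factors [u^p] and 1, with conjugate exponents [1 / p] and
    [1 / (1 - p)]. *)
Lemma powR_young u : 0 <= u -> u `^ p <= p * u + (1 - p).
Proof.
move=> u0; have := @conjugate_powR R (u `^ p) 1 p^-1 (1 - p)^-1.
rewrite powR_ge0 ler01 !invr_gt0 p0 subr_gt0 p1 !invrK addrC subrK powR1 !mulr1.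
rewrite mul1r -powRrM mulfV ?gt_eqF// powRr1// (mulrC u).
by move=> /(_ isT isT isT isT erefl).
Qed.

Lemma powR_tangent s M : 0 <= s -> 0 < M ->
  p * (M - s) * M `^ (p - 1) <= M `^ p - s `^ p.
Proof.
move=> s0 M0; have := powR_young (divr_ge0 s0 (ltW M0)).
have MM : M * M `^ (p - 1) = M `^ p by rewrite mulr_powRB1// ltW.
have sM : s `^ p = (s / M) `^ p * M `^ p.
  by rewrite -powRM ?divr_ge0 ?(ltW M0)// divfK ?gt_eqF.
have H : 0 < M `^ p by exact: powR_gt0.
rewrite -(ler_pM2r H) -sM => H2.
suff -> : p * (M - s) * M `^ (p - 1) =
  M `^ p - (p * (s / M) + (1 - p)) * M `^ p by lra.
by rewrite -MM; field; rewrite gt_eqF.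
Qed.

Lemma powR_chord s M : 0 <= s <= M -> 0 < M -> s * M `^ (p - 1) <= s `^ p.
Proof.
move=> /andP[s0 sM] M0; have [->|sn0] := eqVneq s 0.
  by rewrite mul0r powR_ge0.
have s1 : 0 < s by rewrite lt_def sn0.
have : s / M <= (s / M) `^ p.
  by apply: ger1_powR; rewrite ?(ltW p1)// divr_gt0//= ler_pdivrMr// mul1r.
have H : 0 < M `^ p by exact: powR_gt0.
rewrite -(ler_pM2r H) -powRM ?divr_ge0 ?(ltW M0)// divfK ?gt_eqF//.
by rewrite -[in X in X <= _](@mulr_powRB1 _ M) ?(ltW M0)// mulrA divfK ?gt_eqF.
Qed.

Lemma powR_subadd s t : 0 <= s -> 0 <= t -> (s + t) `^ p <= s `^ p + t `^ p.
Proof.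
move=> s0 t0; have [st|st] := eqVneq (s + t) 0.
  by rewrite st powR0 ?gt_eqF// addr_ge0 ?powR_ge0.
have st0 : 0 < s + t by rewrite lt_def st addr_ge0.
have := powR_chord (s := s) (M := s + t); have := powR_chord (s := t) (M := s + t).
rewrite s0 t0 lerDl lerDr s0 t0 st0 => /(_ isT isT) ? /(_ isT isT) ?.
have := mulr_powRB1 (ltW st0) p0; rewrite mulrDl; lra.
Qed.

Let G t := if 0 <= t then t `^ p else - ((- t) `^ p).

(** [G] is steepest at the origin, so its slope over [[t, t + h]] is at least its derivative at
    distance [|t| + h]. An interval containing the origin is treated by a chord on each side. *)
Let G_slope t h : 0 < h -> p * h * (`|t| + h) `^ (p - 1) <= G (t + h) - G t.
Proof.
move=> h0; rewrite /G; have [t0|t0] := leP 0 t.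
  rewrite ger0_norm// addr_ge0 ?(ltW h0)//.
  have -> : p * h = p * (t + h - t) by congr (_ * _); lra.
  by apply: powR_tangent => //; lra.
rewrite ltr0_norm// opprK; have Mh : 0 < - t + h by lra.
have [th|th] := leP 0 (t + h).
  apply: (@le_trans _ _ (h * (- t + h) `^ (p - 1))).
    rewrite ler_wpM2r ?powR_ge0// ler_piMl ?(ltW h0)//; exact: ltW.
  have := powR_chord (s := t + h) (M := - t + h).
  have := powR_chord (s := - t) (M := - t + h).
  rewrite Mh th => /(_ _ isT) A /(_ _ isT) B.
  have {}A := A ltac:(lra); have {}B := B ltac:(lra); lra.
have -> : p * h = p * (- t - - (t + h)) by congr (_ * _); lra.
rewrite [leRHS]addrC; apply: (@le_trans _ _ (p * (- t - - (t + h)) * (- t) `^ (p - 1))).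
  rewrite ler_wpM2l// ?mulr_ge0 ?(ltW p0)//; first lra.
  by apply: ler_powRn; rewrite ?subr_le0 ?(ltW p1)//; lra.
by apply: powR_tangent; lra.
Qed.

Let G_holder t h : 0 <= h -> G (t + h) - G t <= 2 * h `^ p.
Proof.
move=> h0; rewrite /G; have hp := powR_ge0 h p.
have [t0|t0] := leP 0 t.
  rewrite addr_ge0//; have := powR_subadd t0 h0; lra.
have [th|th] := leP 0 (t + h).
  have : (t + h) `^ p <= h `^ p by apply: ge0_ler_powR; rewrite ?nnegrE ?(ltW p0)//; lra.
  have : (- t) `^ p <= h `^ p by apply: ge0_ler_powR; rewrite ?nnegrE ?(ltW p0)//; lra.
  lra.
have := @powR_subadd (- (t + h)) h; rewrite (_ : - (t + h) + h = - t); last lra.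
by move=> /(_ _ h0); move: hp; lra.
Qed.

Let G_incr t h : 0 <= h -> G t <= G (t + h).
Proof.
rewrite le_eqVlt => /predU1P[<-|h0]; first by rewrite addr0.
have := G_slope t h0; have : 0 <= p * h * (`|t| + h) `^ (p - 1).
  by rewrite !mulr_ge0 ?powR_ge0 ?ltW.
lra.
Qed.

Let G_continuous : continuous G.
Proof.
move=> t; apply/cvgrPdist_lt => e e0.
pose r := (e / 2) `^ p^-1; have r0 : 0 < r by rewrite powR_gt0 ?divr_gt0.
have rE : r `^ p = e / 2.
  by rewrite -powRrM mulVf ?gt_eqF// powRr1// divr_ge0 ?ltW.
apply/nbhs_ballP; exists r => //= u tur.
have H : 2 * `|t - u| `^ p < e.
  rewrite -ltr_pdivlMl// mulrC -rE; apply: gt0_ltr_powR => //.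
  by rewrite nnegrE powR_ge0.
apply: le_lt_trans H; have [tu|tu] := leP t u.
  have ut : 0 <= u - t by lra.
  have := G_holder t ut; have := G_incr t ut.
  by rewrite (addrC t) subrK distrC (distrC t) => ? ?; rewrite !ger0_norm ?subr_ge0.
have ut : 0 <= t - u by lra.
have := G_holder u ut; have := G_incr u ut.
by rewrite (addrC u) subrK => ? ?; rewrite !ger0_norm ?subr_ge0// ltW.
Qed.

(* With [G] the odd antiderivative of [p |t|^(p-1)], the point [z] maximises
   [\sum_i w i * G (t i + z) - L z], where [L] is the total increment over
   [0, 1]; to the right of [z] all slopes are thus at most [L], which also
   excludes that [z] is one of the singularities. *)
Lemma choose_shift1 (I : finType) (P : pred I) (w t : I -> R) :
  (forall i, P i -> 0 < w i) ->
  exists z, [/\ 0 <= z <= 1, forall i, P i -> t i + z != 0 &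
    \sum_(i | P i) w i * `|t i + z| `^ (p - 1) <= 4 / p * \sum_(i | P i) w i].
Proof.
move=> w0.
pose H z := \sum_(i | P i) w i * G (t i + z).
pose L := H 1 - H 0; pose K z := H z - L * z.
have Hc : continuous H.
  move=> z; apply: cvg_big => [|i _]; first exact: add_continuous.
  apply: cvgM; first exact: cvg_cst.
  apply: (@continuous_comp _ _ _ (fun z => t i + z) G).
    by apply: cvgD; [exact: cvg_cst|exact: cvg_id].
  exact: G_continuous.
have Kc : continuous K.
  move=> z; apply: cvgB; first exact: Hc.
  by apply: cvgM; [exact: cvg_cst|exact: cvg_id].
have [c /[!in_itv]/= c01 cmax] := @EVT_max R K 0 1 ler01 (continuous_subspaceT Kc).
have K01 : K 0 = K 1 by rewrite /K /L; lra.
(* Since [K 0 = K 1], a maximum at 1 is one at 0 too; hence [z < 1], which leaves room for [h > 0]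
   on its right. *)
have [z [z01 zmax]] : exists z, 0 <= z < 1 /\
    forall h, 0 < h -> h <= 1 - z -> H (z + h) - H z <= L * h.
  have [c1|c1] := eqVneq c 1.
    exists 0; split; first by rewrite lexx ltr01.
    move=> h h0 h1; have := cmax h; rewrite in_itv/= (ltW h0)/=.
    by rewrite c1 -K01 /K add0r subr0 in h1 * => /(_ h1); lra.
  exists c; split; first by case/andP: c01 => ->; rewrite lt_neqAle c1.
  move=> h h0 h1; have := cmax (c + h); rewrite in_itv/=.
  have /andP[c0 _] := c01; have -> : 0 <= c + h <= 1 by lra.
  by move=> /(_ isT); rewrite /K mulrDr; lra.
have /andP[z0 z1] := z01; pose B := 2 / p * \sum_(i | P i) w i.
have L2 : L <= 2 * \sum_(i | P i) w i.
  rewrite /L /H -sumrB mulr_sumr ler_sum// => i Pi.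
  rewrite -mulrBr mulrC ler_pM2r ?w0//.
  by have := G_holder (t i + 0) ler01; rewrite addr0 powR1 mulr1.
have key h : 0 < h -> h <= 1 - z ->
    \sum_(i | P i) w i * (`|t i + z| + h) `^ (p - 1) <= B.
  move=> h0 hz; rewrite -(ler_pM2l (mulr_gt0 p0 h0)).
  have -> : p * h * B = h * (2 * \sum_(i | P i) w i).
    by rewrite /B; field; rewrite gt_eqF.
  apply: (@le_trans _ _ (L * h)); last by rewrite mulrC ler_pM2l.
  apply: le_trans (zmax _ h0 hz); rewrite /H -sumrB mulr_sumr ler_sum// => i Pi.
  rewrite -mulrBr mulrCA ler_pM2l ?w0// addrA; exact: G_slope.
have nz i : P i -> t i + z != 0.
  move=> Pi; apply/eqP => tz.
  have wi := w0 _ Pi; have B0 : 0 <= B.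
    by rewrite mulr_ge0 ?divr_ge0 ?(ltW p0)// sumr_ge0// => j /w0/ltW.
  (* At [h = x] the singular term alone would be [B + w i], against [key]; a smaller [h] makes it
     larger still. *)
  pose x := (B / w i + 1) `^ (p - 1)^-1.
  have x0 : 0 < x by rewrite powR_gt0// ltr_wpDl// divr_ge0// ltW.
  pose h := Num.min (1 - z) x.
  have h0 : 0 < h by rewrite lt_min x0 subr_gt0 z1.
  have := key h h0 _; rewrite ge_min lexx => /(_ isT).
  rewrite (bigD1 i)//= tz normr0 add0r.
  have : 0 <= \sum_(j | P j && (j != i)) w j * (`|t j + z| + h) `^ (p - 1).
    by apply: sumr_ge0 => j /andP[/w0/ltW ? _]; rewrite mulr_ge0// powR_ge0.
  suff : w i * (B / w i + 1) <= w i * h `^ (p - 1).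
    have -> : w i * (B / w i + 1) = B + w i by field; rewrite gt_eqF.
    lra.
  rewrite ler_pM2l//.
  have -> : B / w i + 1 = x `^ (p - 1).
    rewrite -powRrM mulVf ?subr_eq0 ?lt_eqF// powRr1// addr_ge0// divr_ge0//.
    exact: ltW.
  by apply: ler_powRn; rewrite ?subr_le0 ?(ltW p1)// ge_min lexx orbT.
exists z; split => //; first by rewrite z0 ltW.
(* Now [|t i + z| + h <= 2 |t i + z|]; as [2^(p - 1) >= 1 / 2], removing [h] from [key] costs a
   factor 2. *)
pose h := \big[Num.min/1 - z]_(i | P i) `|t i + z|.
have h0 : 0 < h.
  rewrite /h; elim/big_ind: _ => [|x y x0 y0|i Pi]; rewrite ?subr_gt0//.
    by rewrite lt_min x0.
  by rewrite normr_gt0 nz.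
have hz : h <= 1 - z by exact: bigmin_le_id.
have hi i : P i -> h <= `|t i + z| by move=> Pi; exact: bigmin_le_cond.
have -> : 4 / p * \sum_(i | P i) w i = 2 * B by rewrite /B; field; rewrite gt_eqF.
apply: (@le_trans _ _ (2 * \sum_(i | P i) w i * (`|t i + z| + h) `^ (p - 1)));
  last by rewrite ler_pM2l ?key.
rewrite mulr_sumr ler_sum// => i Pi; rewrite mulrCA ler_pM2l ?w0//.
have tz : 0 < `|t i + z| by rewrite normr_gt0 nz.
apply: (@le_trans _ _ (2 * (2 * `|t i + z|) `^ (p - 1))); last first.
  have := hi _ Pi; rewrite ler_pM2l// => ?.
  by apply: ler_powRn; rewrite ?subr_le0 ?(ltW p1)//; lra.
rewrite powRM ?(ltW tz)// mulrA ler_peMl ?powR_ge0//.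
rewrite mulr_powRB1//.
by rewrite -[leLHS](powRr0 2) ler_powR ?ler1n ?(ltW p0).
Qed.

End one_dim_choice.

Section choose_shift.
Context {R : realType} {d : nat}.
Variable g : R.
Hypotheses (g0 : 0 < g) (gd : g < d%:R).

Let d0 : 0 < d%:R :> R. Proof. exact: lt_trans gd. Qed.
Let p := 1 - g / d%:R.
Let p01 : 0 < p < 1.
Proof.
rewrite /p subr_gt0 ltr_pdivrMr// mul1r gd/= ltrBlDr ltrDl.
by rewrite divr_gt0.
Qed.

(** As [p - 1 = - g / d], the [d] coordinates share the exponent equally, and [|u|] dominates each
    of them. Each share is integrable in one variable because [g < d]. *)
Lemma powR_enorm_prod (u : 'rV[R]_d) : (forall l, u ord0 l != 0) ->
  enorm u `^ (- g) <= \prod_l `|u ord0 l| `^ (p - 1).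
Proof.
move=> u0; have -> : - g = (p - 1) * d%:R by rewrite /p; field; rewrite gt_eqF.
rewrite powRrM powR_mulrn ?powR_ge0// -[X in _ ^+ X]card_ord -prodr_const.
apply: ler_prod => l _; rewrite powR_ge0/=; apply: ler_powRn.
- by rewrite subr_le0 ltW//; case/andP: p01.
- by rewrite normr_gt0.
- exact: coord_le_enorm.
Qed.

(** Coordinates are fixed one at a time: the factors of the first [k], positive because these
    coordinates avoid zero, are the weights with which [choose_shift1] picks the next one. *)
Lemma choose_shift_unit (I : finType) (P : pred I) (v : I -> 'rV[R]_d) k :
  (k <= d)%N -> exists z : 'rV[R]_d,
  [/\ forall l, 0 <= z ord0 l <= 1,
      forall i (l : 'I_d), P i -> (l < k)%N -> v i ord0 l + z ord0 l != 0 &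
      \sum_(i | P i) \prod_(l < d | (l < k)%N)
        `|v i ord0 l + z ord0 l| `^ (p - 1) <= (4 / p) ^+ k * #|P|%:R].
Proof.
elim: k => [_|k IH kd].
  exists 0; split=> // [l|]; first by rewrite mxE lexx ler01.
  rewrite expr0 mul1r; under eq_bigr do rewrite big_pred0_eq.
  by rewrite sumr_const.
have [z [z01 zn zs]] := IH (ltnW kd).
pose o := Ordinal kd.
pose w i := \prod_(l < d | (l < k)%N) `|v i ord0 l + z ord0 l| `^ (p - 1).
have w0 i : P i -> 0 < w i.
  by move=> Pi; apply: prodr_gt0 => l lk; rewrite powR_gt0// normr_gt0 zn.
have [t [t01 tn ts]] := choose_shift1 p01 (fun i => v i ord0 o) w0.
pose z' : 'rV[R]_d := \row_l if l == o then t else z ord0 l.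
have z'o : z' ord0 o = t by rewrite mxE eqxx.
have z'k (l : 'I_d) : (l < k)%N -> z' ord0 l = z ord0 l.
  by move=> lk; rewrite mxE ifF//; apply/eqP => lo; move: lk; rewrite lo ltnn.
exists z'; split.
- by move=> l; rewrite mxE; case: ifP => _.
- move=> i l Pi; rewrite ltnS leq_eqVlt => /predU1P[lk|lk]; last first.
    by rewrite z'k// zn.
  have -> : l = o by exact: val_inj.
  by rewrite z'o tn.
- rewrite exprS -mulrA; apply: le_trans (le_trans ts _); last first.
    by rewrite ler_pM2l// divr_gt0//; case/andP: p01.
  rewrite ler_sum// => i Pi; rewrite (bigD1 o)/=; last by rewrite ltnS.
  rewrite z'o mulrC ler_wpM2r ?powR_ge0// /w.
  rewrite le_eqVlt; apply/predU1P; left.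
  have E (l : 'I_d) : (l < k.+1)%N && (l != o) = (l < k)%N.
    rewrite ltnS ltn_neqAle andbC; congr (_ && _).
  rewrite (eq_bigl _ _ E); apply: eq_bigr => l lk; by rewrite z'k.
Qed.

(** Scaling by [s = e / d] brings the unit cube of shifts into the ball of radius [e]. *)
Lemma choose_shift : exists C : R, 0 < C /\
  forall (I : finType) (P : pred I) (v : I -> 'rV[R]_d) (e : R), 0 < e ->
  exists z : 'rV[R]_d, [/\ enorm z <= e, forall i, P i -> v i + z != 0 &
    \sum_(i | P i) enorm (v i + z) `^ (- g) <= C * #|P|%:R * e `^ (- g)].
Proof.
exists ((4 / p) ^+ d * d%:R `^ g); split.
  by rewrite mulr_gt0 ?powR_gt0// exprn_gt0// divr_gt0//; case/andP: p01.
move=> I P v e e0; pose s := e / d%:R; have s0 : 0 < s by rewrite divr_gt0.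
have [z [z01 zn zs]] := choose_shift_unit P (fun i => s^-1 *: v i) (leqnn d).
have vE i : v i + s *: z = s *: (s^-1 *: v i + z).
  by rewrite scalerDr scalerA divff ?gt_eqF// scale1r.
have dl : (0 < d)%N by rewrite -(ltr_nat R).
exists (s *: z); split.
- rewrite enormZ gtr0_norm//.
  have -> : e = s * (d%:R * 1) by rewrite /s mulr1 divfK// gt_eqF.
  rewrite ler_pM2l//; apply: ler_enorm_dim => l.
  by have /andP[? ?] := z01 l; rewrite ger0_norm.
- move=> i Pi; rewrite vE scaler_eq0 negb_or gt_eqF//=.
  apply/eqP => /rowP /(_ (Ordinal dl)); apply/eqP; rewrite !mxE.
  by have := zn i (Ordinal dl) Pi dl; rewrite mxE.
- under eq_bigr => i _ do
    rewrite vE enormZ (gtr0_norm s0) powRM ?(ltW s0) ?enorm_ge0//.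
  rewrite -mulr_sumr.
  have -> : e `^ (- g) = s `^ (- g) * d%:R `^ (- g).
    by rewrite -powRM ?(ltW s0) ?(ltW d0)// /s divfK// gt_eqF.
  apply: (@le_trans _ _ (s `^ (- g) * ((4 / p) ^+ d * #|P|%:R))); last first.
    have dd : d%:R `^ g * d%:R `^ (- g) = 1 :> R.
      by rewrite powRN divff// gt_eqF// powR_gt0.
    set X := _ ^+ d; rewrite -mulrA [leRHS](_ : _ =
      (d%:R `^ g * d%:R `^ (- g)) * (s `^ (- g) * (X * #|P|%:R))); last by ring.
    by rewrite dd mul1r.
  rewrite ler_pM2l ?powR_gt0//; apply: le_trans zs.
  rewrite ler_sum// => i Pi.
  have H l : (s^-1 *: v i + z) ord0 l != 0.
    by have := zn i l Pi (ltn_ord l); rewrite !mxE.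
  apply: le_trans (powR_enorm_prod H) _.
  rewrite le_eqVlt; apply/predU1P; left; apply: eq_big => l; first by rewrite ltn_ord.
  by move=> _; rewrite mxE.
Qed.

End choose_shift.

(** * Lebesgue measure of balls and the generalised Laplacian *)

Section lebesgue_rV_ball.
Context {R : realType}.
Local Open Scope ereal_scope.

Lemma measurable_coord n (i : 'I_n) :
  measurable_fun setT (fun x : 'rV[R]_n => x ord0 i : R).
Proof. exact: measurable_rVcoor. Qed.

Lemma measurable_oppr_rV n : measurable_fun setT (-%R : 'rV[R]_n -> 'rV[R]_n).
Proof.
apply: measurable_fun_rVcoorP => i.
rewrite (_ : _ \o _ = (-%R \o @rVcoor R n i)%R); last first.
  by apply/funext => x; rewrite /rVcoor /= mxE.
apply: measurableT_comp; last exact: measurable_rVcoor.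
exact: measurable_funN.
Qed.

Lemma measurable_addr_rV n (x : 'rV[R]_n) : measurable_fun setT (+%R x).
Proof.
apply: measurable_fun_rVcoorP => i.
rewrite (_ : _ \o _ = (fun y => x ord0 i + @rVcoor R n i y)%R); last first.
  by apply/funext => y; rewrite /rVcoor /= mxE.
by apply: measurable_funD => //; exact: measurable_rVcoor.
Qed.

(** Induction on the dimension: through [rVcons] the reflection acts on both factors, so the
    reflected measure agrees with the product measure on rectangles, which determine it. *)
Lemma lebesgue_rVN n (A : set 'rV[R]_n) : measurable A ->
  lebesgue_rV n (-%R @^-1` A) = lebesgue_rV n A.
Proof.
elim: n A => [|n IH] A mA.
  congr (lebesgue_rV _ _); apply/seteqP; split => x /=;
  by rewrite (_ : - x = x)%R//; apply/rowP; case.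
rewrite /= /lebesgue_rVS /pushforward.
pose h (p : measurableTypeR R * 'rV[R]_n) :
  measurableTypeR R * 'rV[R]_n := (- p.1, - p.2)%R.
have mh : measurable_fun setT h.
  apply/measurable_fun_pairP; split.
    apply: (@measurableT_comp _ _ _ _ _ _ (-%R : R -> R)).
      exact: measurable_funN.
    exact: measurable_fst.
  apply: (@measurableT_comp _ _ _ _ _ _ (-%R : 'rV[R]_n -> 'rV[R]_n)).
    exact: measurable_oppr_rV.
  exact: measurable_snd.
have E : @rVcons R n @^-1` (-%R @^-1` A) = h @^-1` (@rVcons R n @^-1` A).
  apply/seteqP; split => -[a x] /=; rewrite (_ : - rVcons (a, x) = rVcons (h (a, x)))%R//;
  by apply/rowP => i; rewrite !mxE; case: unliftP => // j _; rewrite mxE.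
rewrite E; symmetry.
apply: (@product_measure_unique _ _ _ _ _ _ _ (pushforward _ h)) => //.
  move=> B C mB mC; rewrite /pushforward.
  transitivity ((lebesgue_measure \x lebesgue_rV n)
    (((-%R : R -> measurableTypeR R) @^-1` B) `*` (-%R @^-1` C))) => //.
  rewrite product_measure1E.
  - by congr (_ * _); [exact: lebesgue_measureN|exact: IH].
  - rewrite -[X in measurable X]setTI; exact: (measurable_funN (f := id)).
  - by rewrite -[X in measurable X]setTI; exact: measurable_oppr_rV.
by rewrite -[X in measurable X]setTI; exact: measurable_rVcons.
Qed.

End lebesgue_rV_ball.

Lemma le_integral_measurable d (T : measurableType d) (R : realType)
    (mu : {measure set T -> \bar R}) (D : set T) (f g : T -> \bar R) :
  measurable D -> measurable_fun D f -> measurable_fun D g ->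
  (forall x, D x -> (f x <= g x)%E) ->
  (\int[mu]_(x in D) f x <= \int[mu]_(x in D) g x)%E.
Proof.
move=> mD mf mg fg; rewrite integralE [leRHS]integralE leeB//.
- apply: ge0_le_integral => //; [exact: measurable_funepos..|].
  by move=> x /mem_set; apply: funepos_le => y /set_mem; exact: fg.
- apply: ge0_le_integral => //; [exact: measurable_funeneg..|].
  by move=> x /mem_set; apply: funeneg_le => y /set_mem; exact: fg.
Qed.

(** * Averages over Euclidean balls *)

Section ball_average.
Context {R : realType} {n : nat}.
Local Notation mu := (@lebesgue_rV R n.+1).
Local Notation V := 'rV[R]_n.+1.
Implicit Types (x y : V) (e : R).

Lemma measurable_dot (c : V) : measurable_fun setT (dot c).
Proof.
apply: measurable_sum => i; apply: measurable_funM => //.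
exact: measurable_coord.
Qed.

Lemma measurable_eball e : measurable (@eball R n.+1 e).
Proof.
have [e0|e0] := leP e 0.
  rewrite (_ : eball e = set0) ?measurable0//; apply/seteqP; split=> // x /=.
  by rewrite /eball/= => /lt_le_trans /(_ e0); rewrite ltNge enorm_ge0.
rewrite (_ : eball e =
    (fun x => \sum_i x ord0 i ^+ 2) @^-1` `]-oo, e ^+ 2[%classic); last first.
  apply/seteqP; split => x; rewrite /eball/= in_itv/=;
  by rewrite -dotxx -sqr_enorm ltr_pXn2r// nnegrE ?enorm_ge0 ?(ltW e0).
rewrite -[X in measurable X]setTI; apply: measurable_sum => // i.
by apply: measurable_funX; exact: measurable_coord.
Qed.

Let box (a b : R) : set V := [set x | forall i, `[a, b]%classic (x ord0 i)].

Let measurable_box a b : measurable (box a b).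
Proof.
by apply: (@measurable_rV_box R n.+1 (fun=> `[a, b]%classic)) => i; exact: measurable_itv.
Qed.

Let mu_box a b : a < b -> mu (box a b) = ((b - a) ^+ n.+1)%:E.
Proof.
move=> ab; rewrite (@lebesgue_rV_box R n.+1 (fun=> `[a, b]%classic))//.
under eq_bigr do rewrite lebesgue_measure_itv/= lte_fin ab -EFinB.
by rewrite prodEFin prodr_const card_ord.
Qed.

Lemma mu_eball_le e : 0 < e -> (mu (eball e) <= ((2 * e) ^+ n.+1)%:E)%E.
Proof.
move=> e0; have -> : 2 * e = e - - e by lra.
rewrite -mu_box; last lra.
apply: le_measure; rewrite ?inE; [exact: measurable_eball|exact: measurable_box|].
move=> x /= xe i; have := le_lt_trans (coord_le_enorm x i) xe.
by rewrite /= in_itv/= ltr_norml => /andP[/ltW -> /ltW ->].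
Qed.

(** Makes the cube with sides [[e / N4, 2 e / N4]] fit in the ball of radius [e / 2], with all
    coordinates at least [e / N4]. *)
Let N4 : R := 4 * n.+1%:R.
Let N40 : 0 < N4. Proof. by rewrite mulr_gt0. Qed.

Let box_eball e : 0 < e -> box (e / N4) (2 * (e / N4)) `<=` eball e.
Proof.
move=> e0 x xb; rewrite /eball/=; apply: (@le_lt_trans _ _ (e / 2)); last lra.
have -> : e / 2 = n.+1%:R * (2 * (e / N4)) by rewrite /N4; field.
apply: ler_enorm_dim => i; have := xb i; rewrite /= in_itv/= => /andP[a b].
by rewrite ger0_norm// (le_trans _ a)// divr_ge0// ltW.
Qed.

Let mu_box_eball e : 0 < e ->
  mu (box (e / N4) (2 * (e / N4))) = ((e / N4) ^+ n.+1)%:E.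
Proof.
move=> e0; have : 0 < e / N4 by rewrite divr_gt0.
by move=> H; rewrite mu_box; [congr (_ ^+ _)%:E|]; lra.
Qed.

Lemma mu_eball_gt0 e : 0 < e -> (0 < mu (eball e))%E.
Proof.
move=> e0; apply: (@lt_le_trans _ _ (mu (box (e / N4) (2 * (e / N4))))).
  by rewrite mu_box_eball// lte_fin exprn_gt0// divr_gt0.
by apply: le_measure; rewrite ?inE//; [exact: measurable_eball|exact: box_eball].
Qed.

Lemma mu_eball_fin e : 0 < e -> mu (eball e) \is a fin_num.
Proof.
move=> e0; rewrite ge0_fin_numE//; apply: le_lt_trans (mu_eball_le e0) _.
exact: ltry.
Qed.

(* A crude lower bound for the mean of [(y ord0 ord0 / e) ^+ 2] over [eball e],
   obtained from a cube contained in the ball. *)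
Definition second_moment_const : R := N4^-1 ^+ 2 * (2 * N4)^-1 ^+ n.+1.

Lemma second_moment_const_gt0 : 0 < second_moment_const.
Proof. by rewrite mulr_gt0 ?exprn_gt0 ?invr_gt0 ?mulr_gt0. Qed.

Lemma second_moment_ge e : 0 < e ->
  ((second_moment_const * e ^+ 2)%:E * mu (eball e) <=
   \int[mu]_(y in eball e) (y ord0 ord0 ^+ 2)%:E)%E.
Proof.
move=> e0; pose b := box (e / N4) (2 * (e / N4)).
apply: (@le_trans _ _ (\int[mu]_(y in b) ((e / N4) ^+ 2)%:E)%E).
  rewrite integral_cst; last exact: measurable_box.
  apply: (@le_trans _ _ (((e / N4) ^+ 2)%:E * ((e / N4) ^+ n.+1)%:E)%E);
    last by rewrite -(mu_box_eball e0); exact: lexx.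
  (* The ball is enlarged to a cube of side [2 e]; comparing the volumes of the two cubes produces
     the power of [(2 * N4)^-1] in the constant. *)
  apply: (@le_trans _ _
    ((second_moment_const * e ^+ 2)%:E * ((2 * e) ^+ n.+1)%:E)%E).
    apply: lee_wpmul2l; last exact: mu_eball_le.
    by rewrite lee_fin mulr_ge0 ?sqr_ge0// ltW// second_moment_const_gt0.
  have -> : (e / N4) ^+ n.+1 = (2 * N4)^-1 ^+ n.+1 * (2 * e) ^+ n.+1.
    by rewrite -exprMn; congr (_ ^+ _); field; rewrite gt_eqF.
  rewrite -!EFinM lee_fin /second_moment_const (exprMn 2 e).
  by rewrite le_eqVlt; apply/predU1P; left; ring.
have ms : measurable_fun (@eball R n.+1 e) (fun y : V => (y ord0 ord0 ^+ 2)%:E).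
  apply/measurable_EFinP; apply: measurable_funTS; apply: measurable_funX.
  exact: measurable_coord.
have nn (y : V) : (0 <= (y ord0 ord0 ^+ 2)%:E)%E by rewrite lee_fin sqr_ge0.
apply: (@le_trans _ _ (\int[mu]_(y in b) (y ord0 ord0 ^+ 2)%:E)%E).
  apply: ge0_le_integral => //.
  - exact: measurable_box.
  - by move=> y _; rewrite lee_fin sqr_ge0.
  - apply: measurable_funS ms; [exact: measurable_eball|exact: box_eball].
  - move=> y /(_ ord0); rewrite /= in_itv/= => /andP[h _].
    rewrite lee_fin ler_pXn2r// nnegrE ?divr_ge0// ?(ltW e0) ?(ltW N40)//.
    by rewrite (le_trans _ h)// divr_ge0// ltW.
apply: ge0_subset_integral => //; [exact: measurable_box|
  exact: measurable_eball|exact: box_eball].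
Qed.

Lemma integrable_eball (f : V -> R) e M : 0 < e -> measurable_fun setT f ->
  (forall y, eball e y -> `|f y| <= M) -> mu.-integrable (eball e) (EFin \o f).
Proof.
move=> e0 mf fM; apply: measurable_bounded_integrable.
- exact: measurable_eball.
- by apply: le_lt_trans (mu_eball_le e0) _; exact: ltry.
- exact: measurable_funTS.
- exists M; split; first exact: num_real.
  by move=> N MN y ey /=; rewrite (le_trans (fM _ ey))// ltW.
Qed.

Lemma integrable_dot (c : V) e : 0 < e ->
  mu.-integrable (eball e) (EFin \o dot c).
Proof.
move=> e0; apply: (@integrable_eball _ _ (enorm c * e)) => //.
  exact: measurable_dot.
move=> y ye; apply: le_trans (dot_le_enorm _ _) _.
by rewrite ler_wpM2l ?enorm_ge0// ltW.
Qed.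

(** The ball and the measure are invariant under [y -> - y], which changes the sign of the
    integrand. *)
Lemma integral_dot (c : V) e : 0 < e ->
  (\int[mu]_(y in eball e) (dot c y)%:E = 0)%E.
Proof.
move=> e0; have idc := integrable_dot c e0.
have mN := @measurable_oppr_rV R n.+1.
have eN : (-%R : V -> V) @^-1` eball e = eball e.
  by apply/seteqP; split => y; rewrite /eball/= enormN.
have fE : (EFin \o dot c) \o -%R = (fun y => - (dot c y)%:E)%E.
  by apply/funext => y /=; rewrite dotNr.
have refl : (\int[mu]_(y in eball e) (EFin \o dot c) y =
    \int[mu]_(y in eball e) - (EFin \o dot c) y)%E.
  rewrite -[RHS](eq_integral _ _ (fun y _ => congr1 (@^~ y) fE)) -[in RHS]eN.
  rewrite -integral_pushforward//.
  - apply: eq_measure_integral => A mA _; exact/esym/lebesgue_rVN.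
  - by apply/measurable_EFinP; exact: measurable_dot.
  - by rewrite eN fE; exact: (integrableN idc).
  - exact: measurable_eball.
have := refl.
rewrite (integralN (integrable_add_def (measurable_eball e) idc)).
have /fineK <- := integrable_fin_num (measurable_eball e) idc.
rewrite -EFinN => -[]; set J := fine _ => JN.
by congr (_%:E); have : J = - J := JN; lra.
Qed.

(* A function touched from below at [x0] by a paraboloid has a generalised
   Laplacian bounded from below there: the linear part averages to zero. *)
Lemma laplacian0_ge (W : V -> \bar R) (x0 c : V) (w0 A B r : R) :
  measurable_fun setT W -> W x0 = w0%:E -> 0 < r -> 0 <= A -> 0 <= B ->
  (forall y, enorm y < r ->
    ((w0 + dot c y + A * y ord0 ord0 ^+ 2 - B * enorm y ^+ 2)%:E <= W (x0 + y)%R)%E) ->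
  ((2 * (n.+1%:R + 2) * (A * second_moment_const - B))%:E <= laplacian0 W x0)%E.
Proof.
move=> mW Wx0 r0 A0 B0 Wge; rewrite /laplacian0 limf_einfE.
apply: (@le_trans _ _ (ereal_inf
  ((fun e => laplacian_eps e W x0) @` [set e | 0 < e < r]))); last first.
  apply: ereal_sup_ubound; exists [set e | 0 < e < r] => //.
  near=> e => /=; apply/andP; split; near: e; first exact: nbhs_right_gt.
  exact: nbhs_right_lt.
apply: le_ereal_inf_tmp => _ [e /= /andP[e0 er] <-].
rewrite /laplacian_eps Wx0 /=.
have mE := @measurable_eball e.
have muE := mu_eball_fin e0; have mu0 := mu_eball_gt0 e0.
set v := fine _; have vE : mu (eball e) = v%:E by rewrite fineK.
have v0 : 0 < v by rewrite -lte_fin -vE.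
(* On the ball [- B |y|^2] is bounded below by [- B e^2], which is merged with the constant [w0]. *)
pose a := w0 - B * e ^+ 2.
pose q (y : V) := y ord0 ord0 ^+ 2.
have iq : mu.-integrable (eball e) (EFin \o q).
  apply: (@integrable_eball _ _ (e ^+ 2)) => //.
    by apply: measurable_funX; exact: measurable_coord.
  move=> y ye; rewrite /q normrX ler_pXn2r// ?nnegrE ?(ltW e0)//.
  exact: le_trans (coord_le_enorm _ _) (ltW ye).
have ia : mu.-integrable (eball e) (cst a%:E).
  by apply: (@integrable_eball (cst a) _ `|a|).
have idc := integrable_dot c e0.
have iAq : mu.-integrable (eball e) (fun y => A%:E * (EFin \o q) y)%E.
  exact: integrableZl.
have lower : ((a + A * second_moment_const * e ^+ 2)%:E * v%:E <=
    \int[mu]_(y in eball e) W (x0 + y)%R)%E.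
  apply: (@le_trans _ _ (\int[mu]_(y in eball e)
      ((cst a%:E \+ (EFin \o dot c)) \+ (fun y => A%:E * (EFin \o q) y)) y))%E.
    rewrite integralD//; last exact: integrableD.
    rewrite integralD// integral_dot// adde0 integral_cst// integralZl//.
    apply: (@le_trans _ _
        (a%:E * v%:E + A%:E * ((second_moment_const * e ^+ 2)%:E * v%:E))%E).
      by rewrite -!EFinM -EFinD lee_fin; lra.
    apply: leeD; first by rewrite -vE; exact: lexx.
    by rewrite lee_wpmul2l ?lee_fin// -vE; exact: second_moment_ge.
  apply: le_integral_measurable => //.
  - by have /integrableP[] := integrableD mE (integrableD mE ia idc) iAq.
  - apply: measurable_funTS; apply: (measurableT_comp mW).
    exact: measurable_addr_rV.
  - move=> y ye /=; rewrite -EFinM -!EFinD.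
    apply: le_trans (Wge y (lt_trans ye er)); rewrite lee_fin /a /q.
    have : enorm y ^+ 2 <= e ^+ 2.
      by rewrite ler_pXn2r ?nnegrE ?enorm_ge0 ?(ltW e0) ?(ltW ye).
    by move=> /(ler_wpM2l B0); lra.
have e2 : 0 < e ^+ 2 by rewrite exprn_gt0.
apply: (@le_trans _ _ ((2 * (n.+1%:R + 2) / e ^+ 2)%:E *
    (v^-1%:E * ((a + A * second_moment_const * e ^+ 2)%:E * v%:E) - w0%:E))%E).
  rewrite -!EFinM lee_fin /a le_eqVlt; apply/predU1P; left.
  by field; rewrite !gt_eqF.
rewrite lee_wpmul2l ?lee_fin ?divr_ge0 ?mulr_ge0 ?(ltW e0)//.
apply: leeD (lexx _).
by rewrite lee_wpmul2l ?lee_fin ?invr_ge0 ?(ltW v0).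
Unshelve. all: by end_near. Qed.

End ball_average.

(** * Comparison with barriers *)

Lemma ereal_between (R : realFieldType) (x y : \bar R) :
  (x < y)%E -> exists r : R, (x < r%:E < y)%E.
Proof.
case: x y => [x| |] [y| |]//.
- by rewrite lte_fin => xy; exists ((x + y) / 2); rewrite !lte_fin; lra.
- by move=> _; exists (x + 1); rewrite lte_fin ltrDl ltr01 ltry.
- by move=> _; exists (y - 1); rewrite lte_fin gtrDl ltrN10 ltNyr.
- by move=> _; exists 0; rewrite ltNyr ltry.
Qed.

(** If [g = W - phi] had no minimum on [K], each point of [K] would have a neighbourhood where [g]
    exceeds some value taken in [K]. The sublevel sets generate a filter, and compactness gives a
    point of [K] at which [g] is below all its values on [K], its own included. *)
Lemma lower_semicontinuous_min (R : realType) (T : topologicalType) (K : set T)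
    (W : T -> \bar R) (phi : T -> R) :
  compact K -> K !=set0 -> lower_semicontinuous W -> continuous phi ->
  exists2 x0, K x0 & forall x, K x -> (W x0 - (phi x0)%:E <= W x - (phi x)%:E)%E.
Proof.
move=> /compact_near_coveringP cK [k Kk] lW cphi.
pose g x := (W x - (phi x)%:E)%E.
apply: contrapT => /forall2NP nomin.
have {}nomin x : K x -> exists2 x', K x' & (g x' < g x)%E.
  move=> Kx; have [//|/existsNP[x' /not_implyP[Kx' /negP]]] := nomin x.
  by rewrite -ltNge; exists x'.
pose F := filter_from K (fun y => [set i | K i /\ (g i <= g y)%E]).
have FF : Filter F.
  apply: filter_from_filter; first by exists k.
  move=> i j Ki Kj; have [ij|ji] := leP (g i) (g j).
    by exists i => // x [Kx xi]; split; split => //; exact: le_trans ij.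
  by exists j => // x [Kx xj]; split; split => //; exact: le_trans (ltW ji).
have [x /= Kx] : \near F, K `<=` (fun x => (g F < g x)%E).
  (* [a] separates the two values of [g], and the margin between [a + phi x] and [b] absorbs the
     variation of [phi] near [x]. *)
  apply: cK => x Kx; have [x' Kx' /ereal_between[a /andP[x'a]]] := nomin x Kx.
  rewrite /g lteBrDr// => /ereal_between[b /andP[]].
  rewrite -EFinD lte_fin => ab bW.
  have [U Ux UW] := lW _ _ bW.
  have e0 : 0 < b - (a + phi x) by rewrite subr_gt0.
  have /cvgrPdist_lt/(_ _ e0) V := cphi x.
  exists (U `&` [set t | `|phi x - phi t| < b - (a + phi x)],
          [set i | K i /\ (g i <= g x')%E]).
    by split; [exact: filterI|exists x'].
  move=> [t i] [[Ut Vt] [Ki ix']].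
  have /lt_trans : (g i < a%:E)%E := le_lt_trans ix' x'a.
  apply; rewrite /g lteBrDr//.
  apply: lt_trans (UW _ Ut); rewrite -EFinD lte_fin.
  by move: Vt => /=; rewrite ltr_norml; lra.
by move=> /(_ x) /(_ (conj Kx (lexx _)) _ Kx); rewrite ltxx.
Qed.

(** Convexity at [u = t / t0], from [ln u <= u - 1] multiplied by [s <= 0] and [exp y >= 1 + y]. *)
Lemma powR_tangentN (R : realType) (s t t0 : R) : s <= 0 -> 0 < t -> 0 < t0 ->
  t0 `^ s + s * t0 `^ (s - 1) * (t - t0) <= t `^ s.
Proof.
move=> s0 tp t0p; have u0 : 0 < t / t0 by rewrite divr_gt0.
have H : 1 + s * (t / t0 - 1) <= (t / t0) `^ s.
  rewrite /powR gt_eqF//; apply: le_trans (expR_ge1Dx _).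
  rewrite lerD2l ler_wnM2l//.
  by have := @le_ln1Dx R (t / t0 - 1); rewrite (addrC 1) subrK; apply; lra.
have E : t `^ s = (t / t0) `^ s * t0 `^ s.
  by rewrite -powRM ?(ltW u0) ?(ltW t0p)// divfK ?gt_eqF.
have -> : t0 `^ (s - 1) = t0 `^ s / t0.
  by rewrite powRB ?powRr1 ?(ltW t0p)// (gt_eqF t0p) implybT.
have P : 0 < t0 `^ s by rewrite powR_gt0.
rewrite E; apply: le_trans (ler_wpM2r (ltW P) H).
by rewrite le_eqVlt; apply/predU1P; left; field; rewrite gt_eqF.
Qed.

Section barriers.
Context {R : realType} {n : nat}.
Local Notation V := 'rV[R]_n.+1.
Variables (W : V -> \bar R) (m : R).
Hypotheses (mW : measurable_fun setT W) (lW : lower_semicontinuous W).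
Hypothesis Wm : forall x, (m%:E <= W x)%E.

Let W_fin x : W x != +oo%E -> W x = (fine (W x))%:E.
Proof.
by move=> Wx; rewrite fineK// fin_numE Wx andbT; case: (W x) (Wm x).
Qed.

Section repulsive.
Variables (g delta C : R).
Hypotheses (g0 : 0 < g) (delta0 : 0 < delta) (C0 : 0 < C).
Hypothesis lapW : forall x, 0 < enorm x < delta ->
  ((C * enorm x `^ (- (g + 2)))%:E <= - laplacian0 W x)%E.
Hypothesis lapW0 : laplacian0 W 0 = -oo%E.

Let s : R := - (g / 2).
(** Normalised so that a touching point allows at most [C / 2 * t0^(s - 1)] for [- laplacian0 W],
    half of what repulsivity demands. *)
Let a : R := C / (4 * (n.+1%:R + 2) * (g / 2)).
Let r : R := delta / 2.

Let a0 : 0 < a.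
Proof. by rewrite divr_gt0// mulr_gt0 ?divr_gt0// mulr_gt0// addr_gt0. Qed.

Let s0 : s <= 0.
Proof. by rewrite oppr_le0 divr_ge0// ltW. Qed.

(** A continuous regularisation of [a |x|^(- g)], as [2 s = - g]. *)
Let phi (tau : R) (x : V) := a * (enorm x ^+ 2 + tau ^+ 2) `^ s.

Let t0_gt0 tau (x : V) : 0 < tau -> 0 < enorm x ^+ 2 + tau ^+ 2.
Proof. by move=> tau0; rewrite ltr_wpDl ?sqr_ge0// exprn_gt0. Qed.

Let continuous_phi tau : 0 < tau -> continuous (phi tau).
Proof.
move=> tau0 x.
have -> : phi tau = fun x => a * expR (s * ln (enorm x ^+ 2 + tau ^+ 2)).
  by apply/funext => y; rewrite /phi /powR gt_eqF ?t0_gt0.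
apply: (@continuous_comp _ _ _ (@enorm R n.+1)
  (fun t : R => a * expR (s * ln (t ^+ 2 + tau ^+ 2)))).
  exact: continuous_enorm.
apply: cvgM; first exact: cvg_cst.
apply: (@continuous_comp _ _ _ (fun t : R => s * ln (t ^+ 2 + tau ^+ 2)) expR);
  last exact: continuous_expR.
apply: cvgM; first exact: cvg_cst.
apply: (@continuous_comp _ _ _ (fun t : R => t ^+ 2 + tau ^+ 2) (@ln R)).
  by apply: cvgD; [exact: exprn_continuous|exact: cvg_cst].
exact/continuous_ln/t0_gt0.
Qed.

(* [W - phi] attains its minimum over the ball on the sphere: elsewhere, by
   convexity of [t |-> t `^ s], [W] would be touched from below by a paraboloid
   that contradicts the repulsivity. *)
Let barrier tau x : 0 < tau -> enorm x <= r ->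
  ((phi tau x + m - a * r `^ (- g))%:E <= W x)%E.
Proof.
move=> tau0 xr.
have [x0 x0r x0min] := @lower_semicontinuous_min _ _ [set x | enorm x <= r] W (phi tau)
   (compact_sub_enorm (@closed_enorm_le _ _ r) (fun x => id))
   (ex_intro _ x xr) lW (continuous_phi tau0).
suff H : ((m - a * r `^ (- g))%:E <= W x0 - (phi tau x0)%:E)%E.
  have := le_trans H (x0min x xr); rewrite leeBrDr// -EFinD.
  by congr (_%:E <= _)%E; lra.
have [->|Wx0] := eqVneq (W x0) +oo%E; first by rewrite leey.
have := Wm x0; rewrite (W_fin Wx0); set w0 := fine _ => mw0.
rewrite -EFinB lee_fin; rewrite lee_fin in mw0.
have r0 : 0 < r by rewrite divr_gt0.
have t0p := t0_gt0 x0 tau0.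
move: x0r => /=; rewrite le_eqVlt => /predU1P[x0r|x0r].
  rewrite lerB// ler_pM2l// x0r.
  have -> : r `^ (- g) = (r ^+ 2) `^ s.
    by rewrite -powR_mulrn ?(ltW r0)// -powRrM; congr (_ `^ _); rewrite /s; lra.
  by apply: ler_powRn; rewrite ?exprn_gt0// lerDl sqr_ge0.
exfalso; set t0 := _ + _ in t0p.
pose B := a * (g / 2) * t0 `^ (s - 1).
have B0 : 0 <= B.
  apply: mulr_ge0 (powR_ge0 _ _).
  by apply: mulr_ge0 (ltW a0) (divr_ge0 (ltW g0) _).
(* By [powR_tangentN] at [t0], with increment [2 <x0, y> + |y|^2] and slope [- B / a]. *)
have touch y : enorm y < r - enorm x0 ->
    ((w0 + dot ((- 2 * B) *: x0) y + 0 * y ord0 ord0 ^+ 2 - B * enorm y ^+ 2)%:E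
       <= W (x0 + y)%R)%E.
  move=> yr; have x0yr : enorm (x0 + y) <= r.
    by apply: le_trans (ler_enormD _ _) _; move: yr; lra.
  have := x0min _ x0yr; rewrite leeBrDr// (W_fin Wx0) -/w0 -EFinB -EFinD.
  apply: le_trans; rewrite lee_fin mul0r addr0 dotZl.
  have := powR_tangentN s0 (t0_gt0 (x0 + y) tau0) t0p.
  rewrite -(ler_pM2l a0) -/(phi _ _) -/t0.
  have -> : enorm (x0 + y) ^+ 2 + tau ^+ 2 - t0 = 2 * dot x0 y + enorm y ^+ 2.
    by rewrite sqr_enormD /t0; ring.
  rewrite /B /phi -/t0 /s; lra.
have := laplacian0_ge mW (W_fin Wx0) _ (lexx 0) B0 touch.
rewrite subr_gt0 x0r mul0r sub0r => /(_ isT) lap.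
have [x00|x00] := eqVneq x0 0; first by move: lap; rewrite x00 lapW0.
have e0 : 0 < enorm x0 by rewrite enorm_gt0.
have := @lapW x0; rewrite e0 /= => /(_ _).
have -> : enorm x0 < delta by have := delta0; move: x0r; rewrite /r; lra.
move=> /(_ isT) /le_trans; move: lap; rewrite -leeN2 => /[swap] /[apply].
rewrite -EFinN lee_fin; apply/negP; rewrite -ltNge.
have -> : - (2 * (n.+1%:R + 2) * - B) = C / 2 * t0 `^ (s - 1).
  rewrite /B /a; field.
  by rewrite !gt_eqF// addr_gt0.
have P : 0 < enorm x0 `^ (- (g + 2)) by rewrite powR_gt0.
apply: (@le_lt_trans _ _ (C / 2 * enorm x0 `^ (- (g + 2)))).
  rewrite ler_pM2l ?divr_gt0//.
  have -> : enorm x0 `^ (- (g + 2)) = (enorm x0 ^+ 2) `^ (s - 1).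
    by rewrite -powR_mulrn ?(ltW e0)// -powRrM; congr (_ `^ _); rewrite /s; lra.
  apply: ler_powRn; rewrite ?exprn_gt0//; first by have := s0; lra.
  by rewrite /t0 lerDl sqr_ge0.
by rewrite ltr_pM2r//; have := C0; lra.
Qed.

(** The parameter of [barrier] is free: at the origin [tau -> 0] forces an infinite value, and
    elsewhere [tau = |x|] gives a multiple of [|x|^(- g)]. *)
Lemma repulsive_lower_bound : W 0 = +oo%E /\ exists r c C1 : R,
  [/\ 0 < r, 0 < c & forall x, x != 0 -> enorm x <= r ->
    ((c * enorm x `^ (- g) - C1)%:E <= W x)%E].
Proof.
have r0 : 0 < r by rewrite divr_gt0.
have tauE (t : R) : 0 < t -> (t ^+ 2) `^ s = t `^ (- g).
  move=> t0; rewrite -powR_mulrn ?(ltW t0)// -powRrM.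
  by congr (_ `^ _); rewrite /s; lra.
split.
  apply/eqP/negPn/negP => W0; set C1 := a * r `^ (- g) - m.
  have H (tau : R) : 0 < tau -> a * tau `^ (- g) - C1 <= fine (W 0).
    move=> tau0; rewrite -lee_fin -(W_fin W0).
    apply: le_trans (barrier tau0 (_ : enorm 0 <= r)); rewrite ?enorm0 ?(ltW r0)//.
    rewrite lee_fin /phi enorm0 expr0n add0r tauE// /C1; lra.
  (* With [tau = X^(- 1 / g)], [a * tau^(- g)] exceeds [|W 0| + |C1|] by 1, which contradicts
     [H]. *)
  pose X := (`|fine (W 0)| + `|C1| + 1) / a.
  have X0 : 0 < X by rewrite divr_gt0// ltr_wpDl// addr_ge0.
  have := H (X `^ (- g)^-1) (powR_gt0 _ X0).
  rewrite -powRrM mulVf ?oppr_eq0 ?gt_eqF// powRr1 ?(ltW X0)//.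
  rewrite /X mulrC divfK ?gt_eqF//; apply/negP; rewrite -ltNge.
  have := ler_norm (fine (W 0)); have := ler_norm C1; lra.
exists r, (a * 2 `^ s), (a * r `^ (- g) - m); split => //.
  by rewrite mulr_gt0// powR_gt0.
move=> x x0 xr; have e0 : 0 < enorm x by rewrite enorm_gt0.
apply: le_trans (barrier e0 xr); rewrite lee_fin /phi.
rewrite (_ : enorm x ^+ 2 + _ = 2 * enorm x ^+ 2); last by lra.
rewrite powRM ?sqr_ge0// tauE//; lra.
Qed.

End repulsive.

End barriers.

(** * Growth far from the origin *)

Section growth.
Context {R : realType} {n : nat}.
Local Notation V := 'rV[R]_n.+1.
Variables (W : V -> \bar R) (m CW RW : R).
Hypotheses (mW : measurable_fun setT W) (lW : lower_semicontinuous W).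
Hypothesis Wm : forall x, (m%:E <= W x)%E.
Hypothesis Wfin : forall x, x != 0 -> W x \is a fin_num.
Hypotheses (RW0 : 0 < RW) (W_incr : radially_increasing_outside W RW).
Hypothesis lapW : forall x, (laplacian0 W x <= CW%:E)%E.

(* Comparison of [W] with the quadratic [phi] on the cap [D] below: by [lapW] the
   minimum of [W - phi] lies on its flat side or on its spherical side. *)
Lemma growth_bound (r0 : R) (z v : V) : RW + 1 <= r0 ->
  RW <= enorm z < r0 + 1 -> r0 < enorm v ->
  2 * CW / ((n.+1%:R + 2) * second_moment_const (n := n)) < fine (W z) - m ->
  fine (W z) <= m + 4 * (fine (W v) - m).
Proof.
move=> rR /andP[zR zr] vr; set lam := fine _ - m => lamC.
have RWp := RW0.
have nz (x : V) : 0 < enorm x -> W x = (fine (W x))%:E.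
  by rewrite enorm_gt0 => x0; rewrite fineK// Wfin.
have K0 := @second_moment_const_gt0 R n; set K := second_moment_const in K0 lamC.
have N0 : 0 < n.+1%:R + 2 :> R by rewrite addr_gt0.
have lam0 : 0 <= lam.
  by rewrite subr_ge0 -lee_fin -nz//; apply: lt_le_trans zR.
(* [phi] is [m] on the flat side of the cap, [m + lam / 4] at the point [p] below, and at most
   [m + lam], the value of [W] at [z], on the whole cap. *)
pose phi (y : V) := m + lam * ((y ord0 ord0 - r0 + 1) / 2) ^+ 2.
have cphi : continuous phi.
  move=> y; apply: (@continuous_comp _ _ _ (fun y : V => y ord0 ord0)
    (fun t : R => m + lam * ((t - r0 + 1) / 2) ^+ 2)); first exact: coord_continuous.
  apply: cvgD; first exact: cvg_cst.
  apply: cvgM; first exact: cvg_cst.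
  apply: (@continuous_comp _ _ _ (fun t : R => (t - r0 + 1) / 2) (fun t => t ^+ 2));
    last exact: exprn_continuous.
  apply: cvgM; last exact: cvg_cst.
  apply: cvgD; last exact: cvg_cst.
  by apply: cvgB; [exact: cvg_id|exact: cvg_cst].
pose D := [set y : V | r0 - 1 <= y ord0 ord0] `&` [set y : V | enorm y <= r0 + 1].
have cD : compact D.
  apply: (@compact_sub_enorm _ _ _ (r0 + 1)) => [|x []//].
  apply: closedI; last exact: closed_enorm_le.
  apply: (@preimage_closed _ _ (fun y : V => y ord0 ord0) [set t | r0 - 1 <= t]).
    by move=> x _; exact: coord_continuous.
  exact: closed_ge.
pose p : V := r0 *: delta_mx ord0 ord0.
have p0 : p ord0 ord0 = r0 by rewrite !mxE !eqxx mulr1.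
have pr : enorm p = r0.
  apply/eqP; rewrite -(@eqrXn2 _ 2)// ?enorm_ge0//; last lra.
  rewrite sqr_enorm dotxx (bigD1 ord0)//= p0 big1 ?addr0// => i i0.
  by rewrite !mxE eqxx (negbTE i0) mulr0 expr0n.
have Dp : D p by split=> /=; rewrite ?p0 ?pr; lra.
have [x0 [x0l x0r] x0min] := lower_semicontinuous_min cD (ex_intro _ p Dp) lW cphi.
rewrite /= in x0l x0r.
have e0 : 0 < enorm x0.
  by apply: lt_le_trans (le_trans (ler_norm _) (coord_le_enorm x0 ord0)); lra.
(* Then [W - phi] is nonnegative at [p], so [lam / 4 <= W p - m], and [W p <= W v] by radial
   growth. *)
suff H : phi x0 <= fine (W x0).
  have pp : 0 < enorm p by lra.
  have := x0min _ Dp; rewrite (nz _ e0) (nz _ pp) -!EFinB lee_fin => H2.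
  have : fine (W p) <= fine (W v).
    rewrite -lee_fin -!nz//; last by apply: lt_trans vr; lra.
    by apply/ltW/W_incr; rewrite pr//; lra.
  have phip : phi p = m + lam / 4 by rewrite /phi p0; field.
  move: H H2; rewrite phip /lam; lra.
have [l1|l1] := eqVneq (x0 ord0 ord0) (r0 - 1).
  rewrite /phi l1 (_ : r0 - 1 - r0 + 1 = 0); last by lra.
  by rewrite mul0r expr0n mulr0 addr0 -lee_fin -nz.
have [r1|r1] := eqVneq (enorm x0) (r0 + 1).
  apply: (@le_trans _ _ (fine (W z))).
    have -> : fine (W z) = m + lam by rewrite /lam; lra.
    rewrite lerD2l ler_piMr// exprn_ile1//; first lra.
    have := le_trans (ler_norm _) (coord_le_enorm x0 ord0); lra.
  rewrite -lee_fin -!nz//; last exact: lt_le_trans zR.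
  by apply/ltW/W_incr; rewrite // r1.
(* At an interior minimum [phi] is itself the touching paraboloid, with coefficient [lam / 4]; as
   [lam] is large, the resulting lower bound on the Laplacian exceeds [CW]. *)
exfalso.
have gap1 : 0 < x0 ord0 ord0 - (r0 - 1) by rewrite subr_gt0 lt_neqAle eq_sym l1.
have gap2 : 0 < r0 + 1 - enorm x0 by rewrite subr_gt0 lt_neqAle r1.
pose r := Num.min (x0 ord0 ord0 - (r0 - 1)) (r0 + 1 - enorm x0).
pose c : V := (lam * (x0 ord0 ord0 - r0 + 1) / 2) *: delta_mx ord0 ord0.
have touch y : enorm y < r ->
    ((fine (W x0) + dot c y + lam / 4 * y ord0 ord0 ^+ 2 - 0 * enorm y ^+ 2)%:E
       <= W (x0 + y)%R)%E.
  rewrite lt_min => /andP[y1 y2].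
  have yy := coord_le_enorm y ord0.
  have Dxy : D (x0 + y).
    split=> /=; last by apply: le_trans (ler_enormD _ _) _; lra.
    by rewrite mxE; move: yy; rewrite ler_norml => /andP[]; lra.
  have := x0min _ Dxy; rewrite leeBrDr// (nz _ e0) -EFinB -EFinD.
  apply: le_trans; rewrite lee_fin mul0r subr0.
  have -> : dot c y = lam * (x0 ord0 ord0 - r0 + 1) / 2 * y ord0 ord0.
    rewrite dotZl /dot (bigD1 ord0)//= big1 ?addr0; first by rewrite mxE !eqxx mul1r.
    by move=> i i0; rewrite mxE eqxx (negbTE i0) mul0r.
  by rewrite /phi mxE le_eqVlt /=; apply/predU1P; left; field.
have rp : 0 < r by rewrite lt_min gap1.
have lam4 : 0 <= lam / 4 by rewrite divr_ge0.
have := le_trans (laplacian0_ge mW (nz _ e0) rp lam4 (lexx 0) touch) (lapW x0).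
rewrite lee_fin subr0; apply/negP; rewrite -ltNge -/K.
move: lamC; rewrite ltr_pdivrMr ?mulr_gt0//; lra.
Qed.

End growth.

(** * Discrete minimisers *)

Lemma sum_at_most_one (I : finType) (b : I -> bool) :
  (forall k l, b k -> b l -> k = l) -> (\sum_(k : I) b k <= 1)%N.
Proof.
move=> b1; case: (pickP b) => [k bk|b0]; last by rewrite big1// => k; rewrite b0.
rewrite (bigD1 k)//= big1 ?addn0 ?leq_b1// => l lk.
by apply/eqP; rewrite eqb0; apply: contra lk => bl; apply/eqP/b1.
Qed.

Section minimisers.
Context {R : realType} {n : nat}.
Local Notation V := 'rV[R]_n.+1.
Variables (W : V -> \bar R) (m RW : R).
Hypothesis Wm : forall x, (m%:E <= W x)%E.
Hypothesis W_sym : forall x, W (- x) = W x.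
Hypotheses (RW0 : 0 < RW) (W_incr : radially_increasing_outside W RW).

Let w x := fine (W x).

Lemma W_fin_lty x : (W x < +oo)%E -> W x \is a fin_num.
Proof. by move=> Wx; rewrite fin_numElt Wx andbT (lt_le_trans _ (Wm x)) ?ltNyr. Qed.

Lemma fineW_ge x : W x \is a fin_num -> m <= w x.
Proof. by move=> Wx; rewrite -lee_fin /w fineK. Qed.

Lemma fineW_sym x y : w (x - y) = w (y - x).
Proof. by rewrite /w -[in LHS]W_sym opprB. Qed.

(** Strict increase from [x] to [2 x] leaves no room for [+oo] at [x]. *)
Lemma W_fin_far x : RW <= enorm x -> W x \is a fin_num.
Proof.
move=> xR; apply: W_fin_lty; have x0 : 0 < enorm x := lt_le_trans RW0 xR.
apply: lt_le_trans (W_incr (y := 2 *: x) xR _) (leey _).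
by rewrite enormZ ger0_norm//; lra.
Qed.

Definition finite_pairs N (X : 'I_N -> V) :=
  forall i j, i != j -> W (X i - X j) \is a fin_num.

Definition pair_sum N (X : 'I_N -> V) : R :=
  \sum_(i < N) \sum_(j < N | j != i) w (X i - X j).

Lemma energyE N (X : 'I_N -> V) : finite_pairs X ->
  energy W X = ((2 * N%:R ^+ 2)^-1 * pair_sum X)%:E.
Proof.
move=> fX; rewrite /energy EFinM -sumEFin; congr (_ * _)%E.
apply: eq_bigr => i _; rewrite -sumEFin; apply: eq_bigr => j ji.
by rewrite /w fineK// fX// eq_sym.
Qed.

(** No value of [W] is [-oo], so a single infinite pair makes the energy infinite. *)
Lemma finite_pairs_energy N (X : 'I_N -> V) : (0 < N)%N ->
  (energy W X < +oo)%E -> finite_pairs X.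
Proof.
move=> N0 eX i j ij; apply: W_fin_lty; rewrite ltey; apply: contraTN eX => /eqP Wij.
have nNy x : W x != -oo%E.
  by rewrite gt_eqF// (lt_le_trans _ (Wm x)) ?ltNyr.
have SNy k : (\sum_(j < N | j != k) W (X k - X j) != -oo)%E.
  by apply/negP => /eqP/esum_eqNyP[l [_ _ /eqP]]; rewrite (negbTE (nNy _)).
rewrite -leNgt /energy (_ : \sum_i _ = +oo)%E.
  by rewrite gt0_muley// lte_fin invr_gt0 mulr_gt0 ?exprn_gt0 ?ltr0n.
apply/esum_eqyP => [k _|]; first exact: SNy.
exists i; split; rewrite ?mem_index_enum//.
apply/esum_eqyP => [k _|]; first exact: nNy.
by exists j; split; rewrite ?mem_index_enum// eq_sym.
Qed.

Lemma exists_finite_pairs N : exists Y : 'I_N -> V, finite_pairs Y.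
Proof.
exists (fun i => (i%:R * RW) *: delta_mx ord0 ord0) => i j ij.
apply: W_fin_far; rewrite -scalerBl -mulrBl.
apply: le_trans (coord_le_enorm _ ord0).
rewrite !mxE !eqxx mulr1 normrM (gtr0_norm RW0) ler_peMl ?(ltW RW0)//.
have [ij'|ij'|ij'] := ltngtP i j; last by move: ij; rewrite (val_inj ij') eqxx.
  by rewrite distrC -natrB ?(ltnW ij')// normr_nat ler1n subn_gt0.
by rewrite -natrB ?(ltnW ij')// normr_nat ler1n subn_gt0.
Qed.

Lemma pair_sum_min N (X : 'I_N -> V) : (0 < N)%N -> minimiser W X ->
  finite_pairs X /\
  forall Y : 'I_N -> V, finite_pairs Y -> pair_sum X <= pair_sum Y.
Proof.
move=> N0 minX; have [Y0 fY0] := exists_finite_pairs N.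
have fX : finite_pairs X.
  apply: finite_pairs_energy => //; apply: le_lt_trans (minX Y0) _.
  by rewrite energyE// ltry.
split=> // Y fY; have := minX Y; rewrite !energyE// lee_fin ler_pM2l//.
by rewrite invr_gt0 mulr_gt0 ?exprn_gt0 ?ltr0n.
Qed.

Lemma pair_sum_split N (X : 'I_N -> V) i : pair_sum X =
  2 * (\sum_(j < N | j != i) w (X i - X j)) +
  \sum_(k < N | k != i) \sum_(j < N | (j != k) && (j != i)) w (X k - X j).
Proof.
rewrite /pair_sum (bigD1 i)//= mulrDl !mul1r -addrA; congr (_ + _).
rewrite (eq_bigr (fun k => w (X i - X k) +
    \sum_(j < N | (j != k) && (j != i)) w (X k - X j))); last first.
  move=> k ki; rewrite (bigD1 i)/=; last by rewrite eq_sym.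
  by rewrite fineW_sym.
by rewrite big_split.
Qed.

(** Moving particle [i] changes only its own interactions; the other part of [pair_sum_split]
    cancels. *)
Lemma move_one N (X : 'I_N -> V) i y : minimiser W X ->
  (forall j, j != i -> W (y - X j) \is a fin_num) ->
  \sum_(j < N | j != i) w (X i - X j) <= \sum_(j < N | j != i) w (y - X j).
Proof.
move=> minX fy; have N0 : (0 < N)%N by exact: leq_ltn_trans (leq0n _) (ltn_ord i).
have [fX Xmin] := pair_sum_min N0 minX.
pose Y k := if k == i then y else X k.
have Yi : Y i = y by rewrite /Y eqxx.
have Yk k : k != i -> Y k = X k by rewrite /Y => /negbTE ->.
have fY : finite_pairs Y.
  move=> k l kl; have [ki|ki] := eqVneq k i.
    by move: kl; rewrite ki eq_sym => li; rewrite Yi Yk// fy.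
  have [li|li] := eqVneq l i; last by rewrite !Yk// fX.
  by rewrite li Yi Yk// -W_sym opprB fy.
have := Xmin _ fY; rewrite !(pair_sum_split _ i).
rewrite [X in _ <= _ + X](eq_bigr (fun k =>
    \sum_(j < N | (j != k) && (j != i)) w (X k - X j))); last first.
  by move=> k ki; apply: eq_bigr => j /andP[_ ji]; rewrite !Yk.
rewrite lerD2r ler_pM2l// => /le_trans; apply.
by rewrite le_eqVlt; apply/predU1P; left; apply: eq_bigr => j ji; rewrite Yi Yk.
Qed.

(* Otherwise translating the particles on one side of the slab towards the
   other side would decrease the energy. *)
Lemma no_gap N (X : 'I_N -> V) (c : 'I_n.+1) (a : R) p q : minimiser W X ->
  X p ord0 c <= a -> a + (RW + 1) <= X q ord0 c ->
  exists r, a < X r ord0 c < a + (RW + 1).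
Proof.
move=> minX pa aq; apply: contrapT => /forallNP nor.
have N0 : (0 < N)%N by exact: leq_ltn_trans (leq0n _) (ltn_ord p).
have [fX Xmin] := pair_sum_min N0 minX; have RWp := RW0.
pose B r := a + (RW + 1) <= X r ord0 c.
have nB r : ~~ B r -> X r ord0 c <= a.
  by rewrite /B -ltNge => rl; rewrite leNgt; apply/negP => ra; apply: (nor r); rewrite ra.
pose e : V := delta_mx ord0 c.
pose Y r := if B r then X r - e else X r.
have ec : e ord0 c = 1 by rewrite mxE !eqxx.
have ek k : k != c -> e ord0 k = 0 by move=> /negbTE kc; rewrite mxE eqxx kc.
(* The translation shortens [v], as [|v - e|^2 = |v|^2 - 2 v_c + 1] and [v_c >= RW + 1]; the norm
   stays at least [RW], where [W] increases. *)
have cross r s : B r -> ~~ B s ->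
    W (Y r - Y s) \is a fin_num /\ w (Y r - Y s) < w (X r - X s).
  move=> Br Bs; rewrite /Y Br (negbTE Bs) addrAC.
  set v := X r - X s; have vc : RW + 1 <= v ord0 c.
    by move: (nB _ Bs) Br; rewrite /B /v !mxE; lra.
  have ve : RW <= enorm (v - e).
    apply: le_trans (coord_le_enorm _ c); rewrite mxE [(- e) _ _]mxE ec.
    by rewrite ger0_norm; lra.
  have vlt : enorm (v - e) < enorm v.
    rewrite -(@ltr_pXn2r _ 2) ?nnegrE ?enorm_ge0// sqr_enormD enormN dotNr.
    have -> : dot v e = v ord0 c.
      rewrite /dot (bigD1 c)//= ec mulr1 big1 ?addr0// => k kc.
      by rewrite ek// mulr0.
    have -> : enorm e ^+ 2 = 1.
      rewrite sqr_enorm dotxx (bigD1 c)//= ec expr1n big1 ?addr0// => k kc.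
      by rewrite ek// expr0n.
    lra.
  have fve := W_fin_far ve; split=> //.
  have fv : W v \is a fin_num by apply: W_fin_far; lra.
  by rewrite -lte_fin /w !fineK//; exact: W_incr.
have same r s : B r = B s -> Y r - Y s = X r - X s.
  by move=> Brs; rewrite /Y Brs; case: ifP => // _; rewrite opprB addrA subrK.
have YX r s : r != s -> W (Y r - Y s) \is a fin_num /\ w (Y r - Y s) <= w (X r - X s).
  move=> rs; case Br : (B r); case Bs : (B s).
  - by rewrite same ?Br ?Bs// lexx fX.
  - by have [? /ltW ?] := cross r s Br (negbT Bs).
  - have [] := cross s r Bs (negbT Br).
    by rewrite fineW_sym (fineW_sym (X s)) -W_sym opprB => ? /ltW ?.
  - by rewrite same ?Br ?Bs// lexx fX.
have Bp : ~~ B p by rewrite /B -ltNge; lra.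
have qp : q != p by apply: contraNneq Bp => <-.
have /Xmin : finite_pairs Y by move=> r s /YX[].
apply/negP; rewrite -ltNge /pair_sum !pair_big_dep/=.
(* The pair [(q, p)] straddles the slab and makes the inequality strict. *)
rewrite (bigD1 (q, p))/=; last by rewrite eq_sym.
rewrite [ltRHS](bigD1 (q, p))/=; last by rewrite eq_sym.
apply: ltr_leD; first by have [] := cross q p aq Bp.
apply: ler_sum => -[r s] /= /andP[rs _]; rewrite eq_sym in rs.
by have [] := YX r s rs.
Qed.

Lemma diameter_le_coord N (X : 'I_N -> V) (L : R) : (0 < N)%N ->
  (forall c p q, X q ord0 c - X p ord0 c <= L) ->
  diameter (range X) <= n.+1%:R * L.
Proof.
move=> N0 XL; apply: ge_sup.
  by exists (enorm (X (Ordinal N0) - X (Ordinal N0))); exists (X (Ordinal N0)) => //;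
     exists (X (Ordinal N0)).
move=> _ [_ [p _ <-] [_ [q _ <-] <-]]; apply: ler_enorm_dim => c.
by rewrite !mxE ler_norml XL andbT lerNl opprB XL.
Qed.

(** Otherwise [no_gap] yields one particle at the start of each of [M] consecutive slabs of width
    [D]. They are more than [2 r] apart, so their [r]-neighbourhoods are disjoint and contain at
    least [M c0 N > N] particles in total. *)
Lemma coord_bound_from_count N (X : 'I_N -> V) (r c0 : R) (M : nat) :
  minimiser W X -> 0 < r -> 1 < M%:R * c0 ->
  (forall i, c0 * N%:R <= #|[pred j | enorm (X i - X j) < r]|%:R) ->
  forall c p q, X q ord0 c - X p ord0 c <= M%:R * (RW + 1 + 2 * r).
Proof.
move=> minX r0 Mc count c p q; rewrite leNgt; apply/negP => far.
have RWp := RW0; set D := RW + 1 + 2 * r in far.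
have D0 : 0 < D by rewrite /D; lra.
have N0 : (0 < N)%N by exact: leq_ltn_trans (leq0n _) (ltn_ord p).
have /fin_all_exists[f fP] (k : 'I_M) : exists r : 'I_N,
    X p ord0 c + k%:R * D < X r ord0 c < X p ord0 c + k%:R * D + (RW + 1).
  apply: (no_gap minX (p := p) (q := q)).
    by rewrite lerDl mulr_ge0// ltW.
  have : k.+1%:R * D <= M%:R * D by rewrite ler_pM2r// ler_nat.
  by rewrite -natr1 mulrDl mul1r {2}/D; lra.
have disj j (k l : 'I_M) : enorm (X (f k) - X j) < r -> enorm (X (f l) - X j) < r ->
    k = l.
  move=> kj lj; apply: contrapT => /eqP kl.
  wlog klt : k l kj lj kl / (k < l)%N.
    move=> h; have [kl'|kl'|kl'] := ltngtP k l; first exact: (h k l).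
      by apply: (h l k) => //; rewrite eq_sym.
    by move: kl; rewrite (val_inj kl') eqxx.
  have /andP[_ fk] := fP k; have /andP[fl _] := fP l.
  have kl1 : k%:R * D + D <= l%:R * D.
    by rewrite -{2}(mul1r D) -mulrDl natr1 ler_pM2r// ler_nat.
  have := le_lt_trans (coord_le_enorm _ c) kj.
  have := le_lt_trans (coord_le_enorm _ c) lj.
  rewrite !mxE !ltr_norml => /andP[? ?] /andP[? ?].
  by move: kl1; rewrite {2}/D; lra.
have : (\sum_(k < M) #|[pred j | (enorm (X (f k) - X j) < r)%R]| <= N)%N.
  under eq_bigr do rewrite -sum1_card big_mkcond/=.
  rewrite exchange_big/= -[leqRHS]card_ord -sum1_card leq_sum// => j _.
  apply: leq_trans (sum_at_most_one (b := fun k => enorm (X (f k) - X j) < r) _).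
    by apply: leq_sum => k _; rewrite inE; case: (_ < _).
  exact: disj.
rewrite -(ler_nat R) natr_sum => /(le_trans (ler_sum _ (fun k _ => count (f k)))).
rewrite sumr_const card_ord -[leLHS]mulr_natl mulrA; apply/negP; rewrite -ltNge.
by rewrite ltr_pMl// ltr0n.
Qed.

(** With [k] particles near [X i], itself included, the potential is at least
    [(N - k) A + (k - 1) m]. Comparison with [N (A - tau)] gives [N tau <= k (A - m) + m], and
    [k >= 1] absorbs the last term. *)
Lemma count_from_potential N (X : 'I_N -> V) i (r A tau : R) :
  finite_pairs X -> 0 < r ->
  (forall v, r <= enorm v -> A <= w v) ->
  \sum_(j < N | j != i) w (X i - X j) <= N%:R * (A - tau) ->
  tau / (`|A| + 2 * `|m| + 1) * N%:R <= #|[pred j | enorm (X i - X j) < r]|%:R.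
Proof.
move=> fX r0 Ar potential.
set P := [pred j | _]; set k := #|P|%:R : R.
have Pi : P i by rewrite /= subrr enorm0.
have k1 : 1 <= k by rewrite ler1n; apply/card_gt0P; exists i.
have den : 0 < `|A| + 2 * `|m| + 1 by rewrite ltr_wpDl// addr_ge0// mulr_ge0.
rewrite mulrAC ler_pdivrMr//.
have far : \sum_(j < N | ~~ P j) A <= \sum_(j < N | (j != i) && ~~ P j) w (X i - X j).
  rewrite (eq_bigl (fun j => (j != i) && ~~ P j)); last first.
    by move=> j; case: eqVneq => // ->; rewrite Pi.
  by apply: ler_sum => j /andP[_ /=]; rewrite -leNgt => /Ar.
have near : \sum_(j < N | (j != i) && P j) m <=
    \sum_(j < N | (j != i) && P j) w (X i - X j).
  by apply: ler_sum => j /andP[ji _]; apply/fineW_ge/fX; rewrite eq_sym.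
have kE : k = 1 + \sum_(j < N | (j != i) && P j) 1.
  rewrite /k -sum1_card natr_sum (bigD1 i)//=; congr (_ + _).
  by apply: eq_bigl => j; rewrite andbC.
have NE : N%:R = k + \sum_(j < N | ~~ P j) 1 :> R.
  rewrite /k -sum1_card natr_sum -[N in LHS]card_ord -sum1_card natr_sum.
  by rewrite (bigID P).
have cst (Q : pred 'I_N) (b : R) : \sum_(j | Q j) b = (\sum_(j | Q j) 1) * b.
  by rewrite mulr_suml; apply: eq_bigr => j _; rewrite mul1r.
have sp : \sum_(j < N | j != i) w (X i - X j) =
    \sum_(j < N | (j != i) && P j) w (X i - X j) +
    \sum_(j < N | (j != i) && ~~ P j) w (X i - X j) by exact: bigID.
move: potential; rewrite sp; move: far near; rewrite (cst _ A) (cst _ m).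
move: kE NE; set f := \sum_(_ | _) 1; set g := \sum_(_ | _) 1 => kE NE.
move=> far near potential.
have fE : f = N%:R - k by lra.
have gE : g = k - 1 by lra.
move: far near potential; rewrite gE fE => far near potential.
have key : N%:R * tau <= k * (A - m) + m by lra.
have : k * (A - m) + m <= k * (`|A| + 2 * `|m| + 1).
  have := ler_norm A; have := ler_norm m; have := ler_norm (- m); rewrite normrN.
  move=> m1 m2 A1.
  have : k * (A - m) <= k * (`|A| + `|m|) by rewrite ler_wpM2l//; lra.
  have : `|m| <= k * `|m| by rewrite ler_peMl.
  by lra.
by rewrite (mulrC tau) => /(le_trans key).
Qed.

Lemma diameter_bound (r A tau : R) (N1 : nat) :
  0 < r -> 0 < tau -> (forall v, r <= enorm v -> A <= w v) ->
  (forall N (X : 'I_N -> V) i, (N1 < N)%N -> minimiser W X ->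
    \sum_(j < N | j != i) w (X i - X j) <= N%:R * (A - tau)) ->
  exists K : R, 0 < K /\ forall N (X : 'I_N -> V), (2 <= N)%N ->
    minimiser W X -> diameter (range X) < K.
Proof.
move=> r0 tau0 Ar potential; have RWp := RW0.
(* The second bound serves [N <= N1]: there [X i] alone is at least a fraction [1 / (N1 + 1)] of the
   particles. *)
pose c0 := Num.min (tau / (`|A| + 2 * `|m| + 1)) N1.+1%:R^-1.
have c00 : 0 < c0.
  rewrite lt_min invr_gt0 ltr0n andbT divr_gt0// ltr_wpDl//.
have [M M1] : exists M : nat, 1 < M%:R * c0.
  exists (Num.truncn c0^-1).+1; by rewrite -ltr_pdivrMr// div1r truncnS_gt.
exists (n.+1%:R * (M%:R * (RW + 1 + 2 * r)) + 1); split.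
  by rewrite ltr_wpDl// !mulr_ge0//; lra.
move=> N X N2 minX; have N0 : (0 < N)%N by exact: leq_trans N2.
rewrite ltr_pwDr//; apply: diameter_le_coord => // c p q.
apply: (coord_bound_from_count minX r0 M1) => i.
have [fX _] := pair_sum_min N0 minX.
have [NN1|NN1] := leqP N N1; last first.
  have := count_from_potential fX r0 Ar (potential _ _ i NN1 minX).
  by apply: le_trans; rewrite ler_wpM2r// ge_min lexx.
apply: (@le_trans _ _ 1).
  apply: (@le_trans _ _ (N1.+1%:R^-1 * N%:R)).
    by rewrite ler_wpM2r// ge_min lexx orbT.
  by rewrite mulrC ler_pdivrMr ?ltr0n// mul1r ler_nat (leq_trans NN1).
by rewrite ler1n; apply/card_gt0P; exists i; rewrite inE subrr enorm0.
Qed.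

End minimisers.

(** * Potentials of minimisers and the bounded case (A) *)

Section potential.
Context {R : realType} {n : nat}.
Local Notation V := 'rV[R]_n.+1.
Variables (W : V -> \bar R) (m RW : R) (Winf : \bar R).
Hypothesis Wm : forall x, (m%:E <= W x)%E.
Hypothesis W_sym : forall x, W (- x) = W x.
Hypotheses (RW0 : 0 < RW) (W_incr : radially_increasing_outside W RW).
Hypothesis Winf_Ny : Winf != -oo%E.
Hypothesis W_limit : W x @[x --> enorm_infty] --> Winf.
Hypothesis W_unstable : discretely_unstable W Winf.

Let w x := fine (W x).

Lemma ge_limit_far (A : R) : (A%:E < Winf)%E ->
  exists r, RW <= r /\ forall v, r <= enorm v -> A <= w v.
Proof.
move=> AW; have /= := @W_limit _ (open_ereal_gt' AW).
move=> [M _ MA]; exists (Num.max RW (M + 1)); split; first by rewrite le_max lexx.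
move=> v; rewrite ge_max => /andP[vR vM].
have : (A%:E < W v)%E by apply: MA => /=; lra.
by rewrite -[W v]fineK ?(W_fin_far Wm RW0 W_incr)// lte_fin => /ltW.
Qed.

Lemma le_limit x : RW <= enorm x -> (W x <= Winf)%E.
Proof.
move=> xR; rewrite leNgt; apply/negP => /ereal_between[b /andP[Lb bW]].
have /= := @W_limit _ (open_ereal_lt' Lb).
(* The norm of [t x] is [2 |x| + |M|], beyond both [|x|] and the threshold [M] of the limit. *)
move=> [M _ MA]; pose t := 2 + `|M| / enorm x.
have ex : 0 < enorm x := lt_le_trans RW0 xR.
have t2 : 2 <= t by rewrite lerDl divr_ge0// enorm_ge0.
have tE : enorm (t *: x) = 2 * enorm x + `|M|.
  by rewrite enormZ ger0_norm ?(le_trans _ t2)// /t mulrDl divfK// gt_eqF.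
have : (W (t *: x) < b%:E)%E.
  by apply: MA => /=; rewrite tE; have := ler_norm M; lra.
apply/negP; rewrite -leNgt; apply/ltW/(lt_trans bW)/W_incr => //.
by rewrite tE; have := normr_ge0 M; lra.
Qed.

Lemma fineW_le_limit (L : R) x : Winf = L%:E -> RW <= enorm x -> w x <= L.
Proof.
move=> WL xR; have := le_limit xR.
by rewrite WL -[W x]fineK ?(W_fin_far Wm RW0 W_incr).
Qed.

Lemma exists_le_mean N (f : 'I_N -> R) (a : R) : (0 < N)%N ->
  \sum_i f i <= N%:R * a -> exists k, f k <= a.
Proof.
move=> N0 fa; apply: contrapT => /forallNP fk; move: fa; apply/negP.
rewrite -ltNge -[N in N%:R]card_ord mulr_natl -sumr_const.
apply: ltr_sum => [|i _]; last by rewrite ltNge; apply/negP/fk.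
by apply/hasP; exists (Ordinal N0); rewrite ?mem_index_enum.
Qed.

(** The energy of a minimiser is below [L / 2 - s]; multiplied by [2 N^2], this bounds the sum of
    all potentials by [N^2 (L - 2 s)], and some potential is at most the mean. *)
Lemma unstable_potential (L : R) : Winf = L%:E -> exists s Nbar, 0 < s /\
  forall N (X : 'I_N -> V), (Nbar < N)%N -> minimiser W X ->
  exists k, \sum_(j < N | j != k) w (X k - X j) <= N%:R * (L - 2 * s).
Proof.
move=> WL; have [s [s0 [Nbar [_ unst]]]] := W_unstable.
exists s, Nbar; split=> // N X NN minX.
have N0 : (0 < N)%N by exact: leq_ltn_trans NN.
have [fX _] := pair_sum_min Wm RW0 W_incr N0 minX.
have [Y EY] := unst N NN; have := le_lt_trans (minX Y) EY.
rewrite energyE// WL -EFinM -EFinB lte_fin => H.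
apply: exists_le_mean => //; rewrite -/(pair_sum W X).
have NR : 0 < N%:R :> R by rewrite ltr0n.
have N2 : 0 < 2 * N%:R ^+ 2 :> R by rewrite mulr_gt0 ?exprn_gt0.
move: H; rewrite mulrC ltr_pdivrMr// => /ltW /le_trans; apply.
by rewrite le_eqVlt; apply/predU1P; left; field.
Qed.

Lemma diameter_bound_bounded (M : R) : (forall x, (W x <= M%:E)%E) ->
  exists K : R, 0 < K /\ forall N (X : 'I_N -> V), (2 <= N)%N ->
    minimiser W X -> diameter (range X) < K.
Proof.
move=> WM; have Wfin x : W x \is a fin_num.
  by apply: (W_fin_lty Wm); apply: le_lt_trans (WM x) (ltry _).
have wM x : w x <= M by rewrite -lee_fin fineK.
have [L WL] : exists L, Winf = L%:E.
  suff : (Winf <= M%:E)%E.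
    by move: Winf_Ny; case: (Winf) => // L _ _; exists L.
  rewrite leNgt; apply/negP => /ereal_between[b /andP[Mb /ge_limit_far[r [Rr rM]]]].
  have xR : r <= enorm (r *: delta_mx ord0 ord0 : V).
    apply: le_trans (ler_norm r) (le_trans _ (coord_le_enorm _ ord0)).
    by rewrite !mxE !eqxx mulr1.
  have := rM _ xR; apply/negP; rewrite -ltNge.
  by apply: le_lt_trans (wM _) _; rewrite -lte_fin.
have [s [Nbar [s0 unst]]] := unstable_potential WL.
have [|r [Rr rA]] := @ge_limit_far (L - s / 2); first by rewrite WL lte_fin; lra.
pose N1 := maxn Nbar (Num.truncn ((M - m) / s)).+1.
apply: (diameter_bound Wm W_sym RW0 W_incr (r := r) (A := L - s / 2)
  (tau := s / 2) (N1 := N1)) => //; [exact: lt_le_trans Rr|exact: divr_gt0|].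
move=> N X i; rewrite gtn_max => /andP[NN N1N] minX.
have sN : M - m <= N%:R * s.
  rewrite -ler_pdivrMr//; apply/ltW/(lt_le_trans (truncnS_gt _)).
  by rewrite ler_nat ltnW.
have Ns : 0 <= N%:R * s by rewrite mulr_ge0 ?(ltW s0).
have [k Pk] := unst N X NN minX.
have [ik|ik] := eqVneq k i; first by rewrite -ik; apply: le_trans Pk _; lra.
(* Particle [i] is moved onto [X k]: it meets [X k] at cost at most [M], while the pair of [X k]
   with the old [X i], worth at least [m], disappears. The difference is paid by [N s]. *)
apply: le_trans (move_one Wm W_sym RW0 W_incr minX (fun j _ => Wfin (X k - X j))) _.
rewrite (bigD1 k)//=; move: Pk; rewrite (bigD1 i)/=; last by rewrite eq_sym.
rewrite (eq_bigl (fun j => (j != i) && (j != k))); last by move=> j; rewrite andbC.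
have := wM (X k - X k); have := fineW_ge Wm (Wfin (X k - X i)).
rewrite -!/(w _); lra.
Qed.

End potential.

(** * Repulsive potentials *)

Lemma mvt01 (R : realType) (f df : R -> R) :
  (forall t : R, t \in `[0, 1] -> is_derive t (1 : R) f (df t)) ->
  exists2 c, c \in `[0, 1] & f 1 - f 0 = df c.
Proof.
move=> fd; have f_oo (t : R) : t \in `]0, 1[%R -> is_derive t (1 : R) f (df t).
  by rewrite in_itv/= => /andP[t0 t1]; apply: fd; rewrite in_itv/= !ltW.
have fc : {within `[0, 1], continuous f}.
  by apply: derivable_within_continuous => t /fd[].
have [c c01 ->] := MVT_segment ler01 f_oo fc.
by exists c => //; rewrite subr0 mulr1.
Qed.

(** * Choice of a scale by pigeonhole *)

Section scales.
Context {R : realType} {d : nat}.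
Local Notation V := 'rV[R]_d.
Variable g : R.
Hypothesis g0 : 0 < g.

(* The error made when averaging [|v + z|^(-g)] over shifts [z] of size [e]. *)
Definition shift_error (e : R) (v : V) : R :=
  if enorm v < 2 * e then e `^ (- g) else e * enorm v `^ (- g - 1).

Lemma shift_error_ge0 e v : 0 < e -> 0 <= shift_error e v.
Proof.
by move=> e0; rewrite /shift_error; case: ifP => _; rewrite ?mulr_ge0 ?powR_ge0 ?ltW.
Qed.

(** For [|v| < t e] the error is at most [t^g |v|^(- g)], for [|v| > e / t] the factor [e / |v|] is
    below [t], and in between a constant factor is accepted. *)
Lemma shift_error_le (t e : R) (v : V) : 0 < t <= 2^-1 -> 0 < e -> v != 0 ->
  shift_error e v <= (t `^ g + t + 2 `^ g * (t * e <= enorm v <= e / t)%R%:R)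
                     * enorm v `^ (- g).
Proof.
move=> /andP[t0 t2] e0; rewrite -enorm_gt0; set r := enorm v => r0.
have P : 0 < r `^ (- g) by rewrite powR_gt0.
have gn : - g <= 0 by rewrite oppr_le0 ltW.
have tg := powR_ge0 t g; have te : 0 < t * e by rewrite mulr_gt0.
have g2 : 1 <= 2 `^ g by rewrite -[leLHS](powRr0 2) ler_powR ?ler1n// ltW.
have et2 : 2 * e <= e / t by rewrite ler_pdivlMr//; nra.
have scaled (q : R) : 0 < q -> r <= q * e -> e `^ (- g) <= q `^ g * r `^ (- g).
  move=> q0 rq; have -> : q `^ g * r `^ (- g) = (r / q) `^ (- g).
    by rewrite powRM ?invr_ge0 ?(ltW r0) ?(ltW q0)// mulrC -powR_inv1 ?(ltW q0)//
      -powRrM mulrNN mul1r.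
  by apply: ler_powRn; rewrite ?divr_gt0// ler_pdivrMr// mulrC.
rewrite /shift_error -/r; case: ltP => re.
  have [rte|rte] := ltP r (t * e).
    apply: le_trans (scaled t t0 (ltW rte)) _.
    by rewrite ler_pM2r//= mulr0 addr0; lra.
  have -> : r <= e / t by lra.
  rewrite /= mulr1; have /le_trans := scaled 2 (ltr0Sn _ 1) (ltW re).
  by apply; rewrite ler_pM2r//; lra.
have -> : e * r `^ (- g - 1) = e / r * r `^ (- g).
  rewrite powRD; last by rewrite (gt_eqF r0) implybT.
  by rewrite powR_inv1 ?(ltW r0)//; ring.
rewrite ler_pM2r//; have [ret|ret] := leP r (e / t).
  have -> : t * e <= r by nra.
  have : e / r <= 2^-1 by rewrite ler_pdivrMr//; lra.
  by rewrite /= mulr1; lra.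
have : e / r < t by rewrite ltr_pdivrMr// mulrC -ltr_pdivrMr.
by rewrite andbF mulr0 addr0; lra.
Qed.

(* The annuli [t e_k <= |v| <= e_k / t] are disjoint for [e_k = e t^(3 k)], so that
   for most of the scales [e_k] the error is small compared to [|v|^(-g)]. *)
Lemma exists_scale (eta : R) : 0 < eta -> exists kappa : R, 0 < kappa /\
  forall (I : finType) (P : pred I) (v : I -> V) (e1 : R), 0 < e1 ->
  (forall j, P j -> v j != 0) ->
  exists e, [/\ 0 < e, kappa * e1 <= e, e <= e1 &
    \sum_(j | P j) shift_error e (v j) <= eta * \sum_(j | P j) enorm (v j) `^ (- g)].
Proof.
(* Each scale costs [t^g + t <= 2 a], and the disjoint annuli cost [2^g <= M a] once for all scales,
   so [M] scales cost at most [3 M a = M eta] in total. *)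
move=> eta0; pose a := eta / 3; have a0 : 0 < a by rewrite divr_gt0.
pose t := Num.min 2^-1 (Num.min a (a `^ g^-1)).
have t0 : 0 < t by rewrite !lt_min invr_gt0 a0 powR_gt0 ?ltr0n.
have t2 : t <= 2^-1 by rewrite ge_min lexx.
have ta : t <= a by rewrite !ge_min lexx orbT.
have tga : t `^ g <= a.
  have aE : (a `^ g^-1) `^ g = a by rewrite -powRrM mulVf ?gt_eqF// powRr1// ltW.
  rewrite -[leRHS]aE.
  apply: ge0_ler_powR; rewrite ?nnegrE ?powR_ge0 ?(ltW t0) ?(ltW g0)//.
  by rewrite !ge_min lexx !orbT.
pose M := (Num.truncn (2 `^ g / a)).+1.
have MR : 2 `^ g <= M%:R * a by rewrite -ler_pdivrMr// ltW// truncnS_gt.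
exists (t ^+ 3 ^+ M); split; first by rewrite !exprn_gt0.
move=> I P v e1 e10 vn; pose e (k : nat) := e1 * (t ^+ 3) ^+ k.
have e0 k : 0 < e k by rewrite mulr_gt0// !exprn_gt0.
have t3 : 0 < t ^+ 3 by rewrite exprn_gt0.
have t31 : t ^+ 3 <= 1 by rewrite exprn_ile1// ?ltW//; lra.
have eS k l : (k < l)%N -> e l <= t ^+ 3 * e k.
  move=> kl; rewrite /e mulrCA ler_pM2l// -exprS.
  by apply: ler_wiXn2l => //; exact: ltW.
pose mid (k : nat) (u : V) := t * e k <= enorm u <= e k / t.
have mid1 u : \sum_(k < M) (mid k u)%:R <= 1 :> R.
  rewrite -natr_sum -[leRHS]/(1%:R) ler_nat.
  apply: (@sum_at_most_one 'I_M (fun k => mid k u)) => k l.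
  have lt_absurd (p q : nat) : (p < q)%N -> mid p u -> mid q u -> False.
    move=> /eS pq /andP[h1 _] /andP[_ h2].
    have : e q / t <= t ^+ 2 * e p.
      by rewrite ler_pdivrMr// (le_trans pq)// exprS exprS; nra.
    have : t ^+ 2 * e p < t * e p by rewrite ltr_pM2r// expr2; nra.
    lra.
  move=> mk ml; have [kl|kl|//] := ltngtP k l; last by move=> ?; exact: val_inj.
    by case: (lt_absurd _ _ kl mk ml).
  by case: (lt_absurd _ _ kl ml mk).
pose F := \sum_(j | P j) enorm (v j) `^ (- g).
have F0 : 0 <= F by apply: sumr_ge0 => j _; exact: powR_ge0.
have [|k Pk] := @exists_le_mean R M
    (fun k => \sum_(j | P j) shift_error (e k) (v j)) (eta * F) isT.
  rewrite exchange_big/= /F mulrA mulr_sumr; apply: ler_sum => j Pj.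
  apply: (@le_trans _ _ (\sum_(k < M)
      ((t `^ g + t + 2 `^ g * (mid k (v j))%:R) * enorm (v j) `^ (- g)))).
    by apply: ler_sum => k _; apply: shift_error_le; rewrite ?t0 ?t2 ?vn.
  rewrite -mulr_suml ler_wpM2r ?powR_ge0// big_split/= sumr_const card_ord -mulr_sumr.
  have := ler_wpM2l (powR_ge0 2 g) (mid1 (v j)).
  rewrite -[(_ + _) *+ M]mulr_natl mulr1.
  have : M%:R * (t `^ g + t) <= M%:R * (a + a) by rewrite ler_wpM2l// lerD.
  by rewrite /a in MR *; lra.
exists (e k); split=> //.
  rewrite mulrC /e ler_pM2l//; apply: ler_wiXn2l => //; first exact: ltW.
  exact: ltnW.
by rewrite /e ler_piMr ?(ltW e10)// exprn_ile1// ltW.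
Qed.

End scales.

(** * Well-spread competitors *)

Section spread.
Context {R : realType} {n : nat}.
Local Notation V := 'rV[R]_n.+1.
Variable g : R.
Hypotheses (g0 : 0 < g) (gd : g < n.+1%:R).

(** Points are added one by one: [choose_shift] places the next one so that its interaction with the
    [N] earlier ones is at most [C' N]. The radius [1 / 2] keeps all differences in the unit ball,
    where the upper bound on [W] applies. *)
Lemma exists_spread : exists C : R, 0 < C /\ forall N, exists Y : nat -> V,
  [/\ forall i, (i < N)%N -> enorm (Y i) <= 2^-1,
      forall i j, (j < i)%N -> (i < N)%N -> Y i - Y j != 0 &
      \sum_(i < N) \sum_(j < i) enorm (Y i - Y j) `^ (- g) <= C * N%:R ^+ 2].
Proof.
have [C [C0 shift]] := choose_shift g0 gd.
pose C' := C * 2^-1 `^ (- g).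
have C'0 : 0 < C' by rewrite mulr_gt0// powR_gt0.
exists C'; split=> //; elim=> [|N [Y [Y2 Yn Ys]]].
  by exists (fun=> 0); split=> //; rewrite big_ord0 expr0n mulr0.
have [|z [z2 zn zs]] := shift 'I_N predT (fun j => - Y j) 2^-1; first by rewrite invr_gt0.
pose Y' i := if i == N then z else Y i.
have Y'N : Y' N = z by rewrite /Y' eqxx.
have Y'i i : (i < N)%N -> Y' i = Y i by rewrite /Y' => /ltn_eqF ->.
exists Y'; split.
- move=> i; rewrite ltnS leq_eqVlt => /predU1P[->|iN]; first by rewrite Y'N.
  by rewrite Y'i// Y2.
- move=> i j ji; rewrite ltnS leq_eqVlt => /predU1P[iN|iN].
    have jN : (j < N)%N by rewrite -iN.
    by rewrite iN Y'N Y'i// addrC; exact: (zn (Ordinal jN)).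
  by rewrite !Y'i ?(ltn_trans ji)// Yn.
rewrite big_ord_recr/= Y'N.
have -> : \sum_(i < N) \sum_(j < i) enorm (Y' i - Y' j) `^ (- g) =
    \sum_(i < N) \sum_(j < i) enorm (Y i - Y j) `^ (- g).
  apply: eq_bigr => i _; apply: eq_bigr => j _.
  by rewrite !Y'i// (ltn_trans (ltn_ord j)).
have -> : \sum_(j < N) enorm (z - Y' j) `^ (- g) =
    \sum_(j < N) enorm (- Y j + z) `^ (- g).
  by apply: eq_bigr => j _; rewrite Y'i// addrC.
apply: le_trans (lerD Ys zs) _; rewrite card_ord -(natr1 N).
have NC : 0 <= C' * N%:R by rewrite mulr_ge0// ltW.
have -> : C * N%:R * 2^-1 `^ (- g) = C' * N%:R by rewrite /C' mulrAC.
lra.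
Qed.

Lemma sum_sym_lt N (f : nat -> nat -> R) : (forall i j, f i j = f j i) ->
  \sum_(i < N) \sum_(j < N | j != i) f i j = 2 * \sum_(i < N) \sum_(j < i) f i j.
Proof.
move=> fsym; have lt_sum (i : 'I_N) : \sum_(j < i) f i j = \sum_(j < N | (j < i)%N) f i j.
  by rewrite (big_ord_widen N (f i))// ltnW.
rewrite mulrDl mul1r (eq_bigr _ (fun i _ => lt_sum i)).
have E : \sum_(i < N) \sum_(j < N | (j < i)%N) f i j =
    \sum_(i < N) \sum_(j < N | (i < j)%N) f i j :> R.
  rewrite (exchange_big_dep predT)//=; apply: eq_bigr => i _; apply: eq_bigr => j _.
  exact: fsym.
rewrite [X in _ = _ + X]E -[RHS]big_split/=; apply: eq_bigr => i _.
rewrite (bigID (fun j : 'I_N => (j < i)%N))/=; congr (_ + _); apply: eq_bigl => j.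
  by rewrite -(inj_eq val_inj)/=; case: ltngtP.
by rewrite -(inj_eq val_inj)/=; case: ltngtP.
Qed.

End spread.

(** * Case (B): bounds on potentials *)

Section potential_B.
Context {R : realType} {n : nat}.
Local Notation V := 'rV[R]_n.+1.
Variables (W : V -> \bar R) (m RW g CW : R).
Hypothesis Wm : forall x, (m%:E <= W x)%E.
Hypothesis W_sym : forall x, W (- x) = W x.
Hypotheses (RW0 : 0 < RW) (W_incr : radially_increasing_outside W RW).
Hypotheses (g0 : 0 < g) (gd : g < n.+1%:R) (CW0 : 0 < CW).
Hypothesis Wfin : forall x, x != 0 -> W x \is a fin_num.

Let w x := fine (W x).

Hypothesis w_near : forall x, x != 0 -> enorm x <= 1 -> w x <= CW * enorm x `^ (- g).
Hypothesis w_continuous : forall x, x != 0 -> {for x, continuous w}.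

Lemma fineW_ge_norm x : 0 <= w x + `|m|.
Proof.
have [Wx|Wx] := boolP (W x \is a fin_num).
  by have := fineW_ge Wm Wx; have := ler_norm (- m); rewrite normrN -/(w x); lra.
(* The remaining value is [+oo], which [fine] sends to 0. *)
have -> : w x = 0; last by rewrite add0r.
by rewrite /w; move: Wx (Wm x); case: (W x).
Qed.

Lemma fineW_bounded_annulus (a b : R) : 0 < a ->
  exists B, 0 <= B /\ forall x, a <= enorm x <= b -> w x <= B.
Proof.
move=> a0; pose A := [set x : V | a <= enorm x] `&` [set x : V | enorm x <= b].
have [[x Ax]|A0] := pselect (A !=set0); last first.
  by exists 0; split=> // x /andP[xa xb]; case: A0; exists x.
have cA : compact A.
  apply: (@compact_sub_enorm _ _ _ b) => [|y []//].
  by apply: closedI; [exact: closed_enorm_ge|exact: closed_enorm_le].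
have [|c _ cmax] := @EVT_max_rV R _ w A (ex_intro _ x Ax) cA.
  apply: continuous_in_subspaceT => y; rewrite inE => -[ya _].
  by apply: w_continuous; rewrite -enorm_gt0 (lt_le_trans a0).
exists `|w c|; split=> // y /andP[ya yb]; apply: le_trans (ler_norm _).
by apply: cmax; rewrite inE.
Qed.

(** The pair sum of a minimiser is at most that of a spread configuration, which is of order
    [N^2]. *)
Lemma mean_potential_bounded : exists C, 0 < C /\
  forall N (X : 'I_N -> V), (0 < N)%N -> minimiser W X ->
  exists k, \sum_(j < N | j != k) w (X k - X j) <= N%:R * C.
Proof.
have [C [C0 spread]] := exists_spread g0 gd.
exists (2 * (CW * C)); split; first by rewrite !mulr_gt0.
move=> N X N0 minX; apply: exists_le_mean => //.
have [fX Xmin] := pair_sum_min Wm RW0 W_incr N0 minX.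
have [Y [Y2 Yn Ys]] := spread N.
have Yne (i j : 'I_N) : i != j -> Y i - Y j != 0.
  move=> ij; have [lt|lt|eq] := ltngtP i j; last by move: ij; rewrite (val_inj eq) eqxx.
    by rewrite -oppr_eq0 opprB Yn.
  by rewrite Yn.
have fY : finite_pairs W (fun i : 'I_N => Y i) by move=> i j /Yne/Wfin.
apply: le_trans (Xmin _ fY) _; rewrite /pair_sum.
rewrite (@sum_sym_lt R N (fun i j => fine (W (Y i - Y j)))); last first.
  by move=> i j; exact: (fineW_sym W_sym).
have -> : N%:R * (N%:R * (2 * (CW * C))) = 2 * (CW * (C * N%:R ^+ 2)) by ring.
rewrite ler_pM2l//; apply: le_trans (ler_wpM2l (ltW CW0) Ys).
rewrite mulr_sumr ler_sum// => i _; rewrite mulr_sumr ler_sum// => j _.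
apply: w_near; first exact: Yn.
apply: le_trans (ler_enormD _ _) _; rewrite enormN.
have := Y2 i (ltn_ord i); have := Y2 j (ltn_trans (ltn_ord j) (ltn_ord i)); lra.
Qed.

Hypotheses (mW : measurable_fun setT W) (lW : lower_semicontinuous W).
Hypothesis lapW : forall x, (laplacian0 W x <= CW%:E)%E.

(* [growth_bound] prevents [W] from growing too fast when it is unbounded. *)
Lemma fineW_shift_bound : exists B, 0 <= B /\ forall v z,
  v + z != 0 -> enorm z <= 4^-1 ->
  w (v + z) <= CW * enorm (v + z) `^ (- g) + B + 4 * (w v + `|m|).
Proof.
have [B [B0 wB]] := @fineW_bounded_annulus 1 (RW + 3) ltr01.
pose L := 2 * CW / ((n.+1%:R + 2) * second_moment_const (n := n)).
have L0 : 0 <= L.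
  rewrite divr_ge0 ?mulr_ge0 ?(ltW CW0) ?(ltW (second_moment_const_gt0 (n := n)))//.
exists (B + L + `|m|); split; first by rewrite !addr_ge0.
move=> v z vz z4; have wv := fineW_ge_norm v.
have RWp := RW0; have mm := ler_norm m; have mN := ler_norm (- m).
rewrite normrN in mN; have m0 := normr_ge0 m.
have P0 : 0 <= CW * enorm (v + z) `^ (- g) by rewrite mulr_ge0 ?powR_ge0 ?ltW.
have [vz1|vz1] := leP (enorm (v + z)) 1; first by have := w_near vz vz1; lra.
have [vz2|vz2] := leP (enorm (v + z)) (RW + 3).
  by have := wB (v + z); rewrite (ltW vz1) vz2 => /(_ isT); lra.
have vvz := ler_enormD v z.
(* [growth_bound] is applied with [r0 = |v| - 1 / 2]; since [|z| <= 1 / 4], the point [v + z] has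
   norm below [r0 + 1]. *)
have r0 : RW + 1 <= enorm v - 2^-1 by lra.
have vr : enorm v - 2^-1 < enorm v by lra.
have vzr : RW <= enorm (v + z) < enorm v - 2^-1 + 1 by lra.
have [wL|wL] := ltP L (w (v + z) - m); last by lra.
have := growth_bound mW lW Wm Wfin RW0 W_incr lapW r0 vzr vr wL.
by rewrite -!/(w _); lra.
Qed.

(** Particle [i] is moved to [X k + z], where [X k] has at most the mean potential and
    [choose_shift] controls the singular terms; [fineW_shift_bound] bounds the rest by the potential
    of [X k]. *)
Lemma potential_bounded : exists C, 0 < C /\
  forall N (X : 'I_N -> V) i, (0 < N)%N -> minimiser W X ->
  \sum_(j < N | j != i) w (X i - X j) <= N%:R * C.
Proof.
have [C1 [C10 mean]] := mean_potential_bounded.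
have [B [B0 shiftB]] := fineW_shift_bound.
have [C2 [C20 choose]] := choose_shift g0 gd.
(* Accounts for the index [j = k], at which [X k - X j] vanishes. *)
pose w0 := w 0 + `|m|.
pose C := CW * (C2 * 4^-1 `^ (- g)) + B + 4 * (C1 + `|m| + w0).
have w00 : 0 <= w0 := fineW_ge_norm 0.
exists C; split.
  have : 0 <= CW * (C2 * 4^-1 `^ (- g)).
    by rewrite mulr_ge0 ?(ltW CW0)// mulr_ge0 ?(ltW C20) ?powR_ge0.
  by have := normr_ge0 m; rewrite /C; lra.
move=> N X i N0 minX; have [k Pk] := mean N X N0 minX.
have [|z [z4 zn zs]] := choose 'I_N (fun j => j != i) (fun j => X k - X j) 4^-1.
  by rewrite invr_gt0.
have fin j : j != i -> W (X k + z - X j) \is a fin_num.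
  by move=> ji; rewrite addrAC Wfin// zn.
apply: le_trans (move_one Wm W_sym RW0 W_incr minX fin) _.
have NR : 1 <= N%:R :> R by rewrite ler1n.
have cardN (Q : pred 'I_N) : #|Q|%:R <= N%:R :> R.
  by rewrite ler_nat -[leqRHS]card_ord max_card.
apply: (@le_trans _ _ (\sum_(j < N | j != i)
    (CW * enorm (X k - X j + z) `^ (- g) + B + 4 * (w (X k - X j) + `|m|)))).
  by apply: ler_sum => j ji; rewrite addrAC; apply: shiftB => //; exact: zn.
rewrite !big_split/= -!mulr_sumr.
have S1 : \sum_(j < N | j != i) enorm (X k - X j + z) `^ (- g) <=
    N%:R * (C2 * 4^-1 `^ (- g)).
  apply: le_trans zs _; rewrite [leRHS]mulrCA mulrA -!mulrA ler_wpM2l ?(ltW C20)//.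
  by rewrite ler_wpM2r ?powR_ge0// cardN.
have S2 : \sum_(j < N | j != i) B <= N%:R * B.
  by rewrite sumr_const -[leLHS]mulr_natl ler_wpM2r// cardN.
have S3 : \sum_(j < N | j != i) (w (X k - X j) + `|m|) <= N%:R * (C1 + `|m| + w0).
  apply: (@le_trans _ _ (\sum_(j < N) (w (X k - X j) + `|m|))).
    rewrite [leRHS](bigID (fun j => j != i))/= lerDl sumr_ge0// => j _.
    exact: fineW_ge_norm.
  rewrite (bigD1 k)//= subrr -/w0 big_split/= sumr_const -[_ *+ _]mulr_natl.
  have : #|(fun j : 'I_N => j != k)|%:R * `|m| <= N%:R * `|m|.
    by rewrite ler_wpM2r// cardN.
  have : w0 <= N%:R * w0 by rewrite ler_peMl.
  by move: Pk; rewrite -!/(w _); lra.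
move: S3; rewrite big_split/= -(ler_pM2l (_ : 0 < 4))// => S3.
have := ler_wpM2l (ltW CW0) S1; rewrite /C; lra.
Qed.

Lemma diameter_bound_infinite : W x @[x --> enorm_infty] --> +oo%E ->
  exists K : R, 0 < K /\ forall N (X : 'I_N -> V), (2 <= N)%N ->
    minimiser W X -> diameter (range X) < K.
Proof.
move=> W_limit; have [C [C0 potential]] := potential_bounded.
have [r [Rr rC]] := ge_limit_far Wm RW0 W_incr W_limit (ltry (C + 1)).
apply: (diameter_bound Wm W_sym RW0 W_incr (r := r)
  (A := C + 1) (tau := 1) (N1 := 0)) => //.
  exact: lt_le_trans Rr.
by move=> N X i N0 minX; rewrite addrK; exact: potential.
Qed.

(** * Case (B) with a finite limit *)

Section finite_limit.
Variables (L : R) (Winf : \bar R).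
Hypotheses (WL : Winf = L%:E) (W_limit : W x @[x --> enorm_infty] --> Winf).
Hypothesis W0y : W 0 = +oo%E.
Variables (r1 c1 C1 : R).
Hypotheses (r10 : 0 < r1) (c10 : 0 < c1).
Hypothesis W_lower : forall x, x != 0 -> enorm x <= r1 ->
  ((c1 * enorm x `^ (- g) - C1)%:E <= W x)%E.
Hypothesis w_diff : forall x, x != 0 -> differentiable w x.
Hypothesis w_grad : forall x, 0 < enorm x <= 1 ->
  enorm (gradient w x) <= CW * enorm x `^ (- g - 1).

Lemma fineW_lower : exists dl, [/\ 0 < dl, dl <= 2^-1 &
  forall x, x != 0 -> enorm x <= dl -> c1 / 2 * enorm x `^ (- g) <= w x].
Proof.
pose X := (2 * `|C1| + 1) / c1.
have X0 : 0 < X by rewrite divr_gt0// ltr_wpDl// mulr_ge0.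
exists (Num.min (Num.min r1 2^-1) (X `^ (- g)^-1)); split.
- by rewrite !lt_min r10 invr_gt0 ltr0n powR_gt0.
- by rewrite !ge_min lexx orbT.
move=> x x0; rewrite !le_min => /andP[/andP[xr _] xX].
have e0 : 0 < enorm x by rewrite enorm_gt0.
have := W_lower x0 xr; rewrite -[W x]fineK ?Wfin// lee_fin -/(w x).
have : X <= enorm x `^ (- g).
  have XE : (X `^ (- g)^-1) `^ (- g) = X.
    by rewrite -powRrM mulVf ?oppr_eq0 ?gt_eqF// powRr1// ltW.
  by rewrite -[leLHS]XE; apply: ler_powRn => //; rewrite oppr_le0 ltW.
rewrite /X ler_pdivrMr//; have := ler_norm C1; lra.
Qed.

Lemma derive_dot_gradient x z : x != 0 -> 'D_z w x = dot z (gradient w x).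
Proof.
move=> x0; have dw := w_diff x0.
rewrite deriveE// {1}[z]row_sum_delta linear_sum; apply: eq_bigr => i _.
by rewrite linearZ /= mxE deriveE.
Qed.

(** Mean value theorem on the segment from [v] to [v + z], whose points have norm between [|v| / 2]
    and 1, where the gradient bound applies. *)
Lemma fineW_lipschitz : exists C, 0 < C /\ forall v z, v != 0 ->
  enorm v <= 2^-1 -> enorm z <= enorm v / 2 ->
  w (v + z) <= w v + C * (enorm z * enorm v `^ (- g - 1)).
Proof.
exists (CW * 2^-1 `^ (- g - 1)); split; first by rewrite mulr_gt0// powR_gt0.
move=> v z v0 v2 zv; have e0 : 0 < enorm v by rewrite enorm_gt0.
have seg (t : R) : t \in `[0, 1] -> enorm v / 2 <= enorm (v + t *: z) <= 1.
  rewrite in_itv/= => /andP[t0 t1].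
  have tz : enorm (t *: z) <= enorm v / 2.
    rewrite enormZ ger0_norm//; apply: le_trans zv.
    by rewrite ler_piMl ?enorm_ge0.
  have h1 := ler_enormD v (t *: z).
  have := ler_enormD (v + t *: z) (- (t *: z)); rewrite addrK enormN => h2.
  by lra.
have segn (t : R) : t \in `[0, 1] -> v + t *: z != 0.
  by move=> /seg /andP[h _]; rewrite -enorm_gt0 (lt_le_trans _ h)// divr_gt0.
pose f (t : R) := w (v + t *: z).
have fE (t h : R) : f (h *: 1 + t) = w (h *: z + (v + t *: z)).
  by rewrite /f [h *: 1]mulr1 scalerDl addrCA.
have df (t : R) : t \in `[0, 1] -> is_derive t (1 : R) f (dot z (gradient w (v + t *: z))).
  move=> t01; have x0 := segn _ t01.
  have dw : derivable w (v + t *: z) z by exact: diff_derivable (w_diff x0).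
  have E : (fun h : R => h^-1 *: ((f \o shift t) (h *: 1) - f t)) =
           (fun h : R => h^-1 *: ((w \o shift (v + t *: z)) (h *: z) - w (v + t *: z))).
    by apply/funext => h /=; rewrite fE.
  split; first by rewrite /derivable E.
  by rewrite /derive E; exact: derive_dot_gradient.
have [c c01 fc] := mvt01 df.
have := fc; rewrite /f scale1r scale0r addr0.
move=> fcE; rewrite -lerBlDl fcE.
apply: le_trans (ler_norm _) (le_trans (dot_le_enorm _ _) _).
rewrite mulrCA ler_wpM2l ?enorm_ge0//.
have /andP[ca cb] := seg _ c01.
have c0 : 0 < enorm (v + c *: z) by rewrite enorm_gt0 segn.
apply: le_trans (w_grad _) _; first by rewrite c0.
rewrite -mulrA ler_pM2l// -powRM ?invr_ge0 ?enorm_ge0//.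
apply: ler_powRn; rewrite ?mulr_gt0 ?invr_gt0//; last by rewrite mulrC.
by have := g0; lra.
Qed.

(** Uniform continuity on a compact annulus; beyond it [w v] is at least [L - eta] and [w (v + z)]
    at most [L]. *)
Lemma fineW_shift_far (dl eta : R) : 0 < dl -> 0 < eta ->
  exists e, 0 < e /\ forall v z, dl <= enorm v -> enorm z <= e ->
    w (v + z) <= w v + eta.
Proof.
move=> dl0 eta0; have AL : ((L - eta)%:E < Winf)%E by rewrite WL lte_fin; lra.
have [rho [rhoR wrho]] := ge_limit_far Wm RW0 W_incr W_limit AL.
pose K := [set v : V | dl <= enorm v] `&` [set v : V | enorm v <= rho + 1].
have cK : compact K.
  apply: (@compact_sub_enorm _ _ _ (rho + 1)) => [|y []//].
  by apply: closedI; [exact: closed_enorm_ge|exact: closed_enorm_le].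
have FF : Filter (nbhs (0 : V)) := nbhs_filter _.
have [|e [e0 eK]] := nbhs_enormP (x := 0 : V)
    (U := [set z | K `<=` [set v | w (v + z) <= w v + eta]]).
  apply: (iffLR (compact_near_coveringP K) cK V (nbhs (0 : V))
    (fun z v => w (v + z) <= w v + eta) FF) => v [vdl _].
  have v0 : v != 0 by rewrite -enorm_gt0 (lt_le_trans dl0).
  have cv := @w_continuous v v0.
  have eta2 : 0 < eta / 2 by rewrite divr_gt0.
  have /nbhs_enormP[e [e0 eU]] : nbhs v [set u | `|w v - w u| < eta / 2].
    by apply: (iffLR (@cvgrPdist_lt _ _ _ (nbhs v) (nbhs_filter v) w (w v)) cv).
  have e2 : 0 < e / 2 by rewrite divr_gt0.
  exists ([set u | enorm (u - v) < e / 2], [set u : V | enorm (u - 0) < e / 2]).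
    by split; exact: nbhs_enorm_ball.
  move=> [v' z] /= [v'v]; rewrite subr0 => z2.
  have /= := eU v'; rewrite (lt_trans v'v); last by lra.
  have /= := eU (v' + z); rewrite addrAC (le_lt_trans (ler_enormD _ _)); last by lra.
  move=> /(_ isT) + /(_ isT); rewrite !ltr_norml; lra.
exists (Num.min (e / 2) 1); split; first by rewrite lt_min divr_gt0 ?ltr01.
move=> v z vdl; rewrite le_min => /andP[ze z1].
have [vr|vr] := leP (enorm v) (rho + 1).
  by apply: (eK z); rewrite ?subr0; [lra|split].
have := ler_enormD (v + z) (- z); rewrite addrK enormN => vz.
have h1 : RW <= enorm (v + z) by lra.
have := fineW_le_limit Wm RW0 W_incr W_limit WL h1.
have := wrho v; rewrite -!/(w _) => /(_ _); lra.
Qed.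

Variables (s : R) (Nbar : nat).
Hypothesis s0 : 0 < s.
Hypothesis mean_unstable : forall N (X : 'I_N -> V), (Nbar < N)%N ->
  minimiser W X -> exists k, \sum_(j < N | j != k) w (X k - X j) <= N%:R * (L - 2 * s).

(** Particle [i] is moved to [X k + z] with [|z| <= e]. Of the available [N s], one quarter pays for
    the variation of [w] far from the origin, one quarter for the shift errors of close pairs, and
    one half for [D]: the pair [j = k] and the dropped pair of [X k] with the old [X i]. [D] is
    independent of [N] because [e >= kappa * e1]. *)
Lemma potential_below_limit : exists N1 : nat,
  forall N (X : 'I_N -> V) i, (N1 < N)%N -> minimiser W X ->
  \sum_(j < N | j != i) w (X i - X j) <= N%:R * (L - s).
Proof.
have [dl [dl0 dl2 lower]] := fineW_lower.
have [CG [CG0 lip]] := fineW_lipschitz.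
have s4 : 0 < s / 4 by rewrite divr_gt0.
have [e0 [e00 far]] := fineW_shift_far dl0 s4.
have [C2 [C20 choose]] := choose_shift g0 gd.
pose C3 := CW * C2 + CG; have C30 : 0 < C3 by rewrite addr_gt0// mulr_gt0.
(* [FA] below bounds the singular sum by [N A], and [eta] is chosen so that
   [C3 eta N A = N s / 4]. *)
pose A := (`|L| + `|m|) / (c1 / 2) + 1.
have c12 : 0 < c1 / 2 by rewrite divr_gt0.
have A0 : 0 < A.
  by rewrite /A ltr_wpDl//; apply: divr_ge0 (ltW c12); rewrite addr_ge0.
pose eta := s / 4 / (C3 * A).
have eta0 : 0 < eta by rewrite divr_gt0// mulr_gt0.
have [kappa [kappa0 scale]] := exists_scale (d := n.+1) g0 eta0.
pose e1 := Num.min e0 (dl / 4).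
have e10 : 0 < e1 by rewrite lt_min e00 divr_gt0.
pose D := CW * C2 * (kappa * e1) `^ (- g) + `|m|.
exists (maxn Nbar (Num.truncn (D / (s / 2))).+1) => N X i.
rewrite gtn_max => /andP[NN N1N] minX.
have Ns : D <= N%:R * (s / 2).
  rewrite -ler_pdivrMr ?divr_gt0//; apply/ltW/(lt_le_trans (truncnS_gt _)).
  by rewrite ler_nat ltnW.
have N0 : (0 < N)%N by exact: leq_ltn_trans NN.
have NR0 : 0 <= N%:R :> R by [].
have [k Pk] := mean_unstable NN minX.
have [ik|ki] := eqVneq k i.
  rewrite -ik; apply: le_trans Pk _.
  by have := mulr_ge0 NR0 (ltW s0); lra.
have [fX _] := pair_sum_min Wm RW0 W_incr N0 minX.
pose v j := X k - X j.
have vn j : j != k -> v j != 0.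
  by rewrite eq_sym => /fX; apply: contraTneq; rewrite /v => ->; rewrite W0y.
have fv j : j != k -> m <= w (v j).
  by rewrite eq_sym => /fX; exact: fineW_ge.
pose P j := (j != k) && (enorm (v j) <= dl).
pose F := \sum_(j | P j) enorm (v j) `^ (- g).
(* The potential of [X k] is at most [N |L|], while [w] dominates [c1 / 2 * |v|^(- g)] on [P] and is
   at least [- |m|] elsewhere. *)
have FA : F <= N%:R * A.
  have h1 : (c1 / 2) * F <= \sum_(j | P j) w (v j).
    rewrite mulr_sumr; apply: ler_sum => j /andP[jk jdl].
    by apply: lower => //; exact: vn.
  have h2 : \sum_(j < N | j != k) w (v j) = \sum_(j | P j) w (v j) +
      \sum_(j < N | (j != k) && ~~ (enorm (v j) <= dl)) w (v j) by exact: bigID.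
  have h3 : N%:R * - `|m| <=
      \sum_(j < N | (j != k) && ~~ (enorm (v j) <= dl)) w (v j).
    apply: (@le_trans _ _ (\sum_(j < N | (j != k) && ~~ (enorm (v j) <= dl)) - `|m|)).
      rewrite sumr_const -[leRHS]mulr_natl ler_wnM2r ?oppr_le0// ler_nat.
      by rewrite -[leqRHS]card_ord max_card.
    apply: ler_sum => j /andP[jk _]; apply: le_trans (fv _ jk).
    by have := ler_norm (- m); rewrite normrN; lra.
  have h4 : N%:R * (L - 2 * s) <= N%:R * `|L|.
    by rewrite ler_wpM2l//; have := ler_norm L; lra.
  have NA : (c1 / 2) * (N%:R * A) = N%:R * (`|L| + `|m|) + N%:R * (c1 / 2).
    by rewrite /A; field; rewrite gt_eqF.
  have Nc := mulr_ge0 NR0 (ltW c12).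
  by rewrite -(ler_pM2l c12) NA; move: Pk; rewrite -/(v _) h2; lra.
have F0 : 0 <= F by apply: sumr_ge0 => j _; exact: powR_ge0.
have [|e [ep ek ee1 errF]] := scale _ P v e1 e10.
  by move=> j /andP[jk _]; exact: vn.
(* Particles within [2 e] of [X k] are estimated jointly through the choice of [z], the others one
   by one through the variation of [w]. *)
pose b j := enorm (v j) < 2 * e.
have [z [ze zn zs]] := choose _ (fun j => (j != i) && b j) v e ep.
pose err j := shift_error g e (v j).
have err0 j : 0 <= err j by exact: shift_error_ge0.
pose G j := w (v j) + s / 4 + C3 * ((P j)%:R * err j).
have ee0 : e <= e0 by rewrite (le_trans ee1)// ge_min lexx.
have edl : e <= dl / 4 by rewrite (le_trans ee1)// ge_min lexx orbT.
have bk : b k by rewrite /b /v subrr enorm0; lra.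
have inner : \sum_(j < N | (j != i) && b j) w (v j + z) <=
    CW * C2 * e `^ (- g) + \sum_(j < N | ((j != i) && (j != k)) && b j) G j.
  apply: (@le_trans _ _ (\sum_(j < N | (j != i) && b j) CW * enorm (v j + z) `^ (- g))).
    apply: ler_sum => j jP; have /andP[_ bj] := jP.
    apply: w_near; first exact: zn.
    by have := ler_enormD (v j) z; move: bj; rewrite /b; lra.
  rewrite -mulr_sumr; apply: le_trans (ler_wpM2l (ltW CW0) zs) _.
  (* The index [k] is counted here, as [v k = 0]; it yields the separate term
     [CW * C2 * e^(- g)]. *)
  have cardE : #|(fun j => (j != i) && b j)|%:R =
      1 + \sum_(j < N | ((j != i) && (j != k)) && b j) 1 :> R.
    rewrite -[LHS]sumr_const (bigD1 k)/=; last by apply/andP.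
    by congr (_ + _); apply: eq_bigl => j; rewrite andbAC.
  rewrite cardE; set S1 := \sum_(_ | _) 1.
  have -> : CW * (C2 * (1 + S1) * e `^ (- g)) =
    CW * C2 * e `^ (- g) + S1 * (CW * C2 * e `^ (- g)) by ring.
  rewrite lerD2l mulr_suml; apply: ler_sum => j /andP[/andP[_ jk] bj].
  have jdl : enorm (v j) <= dl by move: bj; rewrite /b; lra.
  have Pj : P j by rewrite /P jk.
  have errE : err j = e `^ (- g) by rewrite /err /shift_error -/(b j) bj.
  have := lower _ (vn _ jk) jdl.
  have := mulr_ge0 (ltW c12) (powR_ge0 (enorm (v j)) (- g)).
  have := mulr_ge0 (ltW CG0) (err0 j).
  by rewrite mul1r /G Pj mul1r /C3 -errE; lra.
have outer : \sum_(j < N | (j != i) && ~~ b j) w (v j + z) <=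
    \sum_(j < N | ((j != i) && (j != k)) && ~~ b j) G j.
  rewrite (eq_bigl (fun j => ((j != i) && (j != k)) && ~~ b j)); last first.
    by move=> j; have [->|] := eqVneq j k; rewrite ?bk ?andbF ?andbT.
  apply: ler_sum => j /andP[/andP[_ jk] bj].
  have bj' : 2 * e <= enorm (v j) by rewrite leNgt.
  have [Pj|Pj] := boolP (P j); last first.
    rewrite /G (negbTE Pj) mul0r mulr0 addr0; apply: far; last exact: le_trans ze ee0.
    by move: Pj; rewrite /P jk /= -ltNge => /ltW.
  have /andP[_ jdl] := Pj.
  have errE : err j = e * enorm (v j) `^ (- g - 1).
    by rewrite /err /shift_error -/(b j) (negbTE bj).
  have jz : enorm z <= enorm (v j) / 2 by lra.
  apply: le_trans (lip _ _ (vn _ jk) (le_trans jdl dl2) jz) _.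
  have : CG * (enorm z * enorm (v j) `^ (- g - 1)) <= CG * err j.
    by rewrite ler_pM2l// errE ler_wpM2r// powR_ge0.
  have := mulr_ge0 (ltW CW0) (mulr_ge0 (ltW C20) (err0 j)).
  by rewrite /G Pj mul1r /C3; lra.
have total : \sum_(j < N | j != i) w (v j + z) <=
    CW * C2 * e `^ (- g) + \sum_(j < N | (j != i) && (j != k)) G j.
  have -> : \sum_(j < N | j != i) w (v j + z) =
    \sum_(j < N | (j != i) && b j) w (v j + z) +
    \sum_(j < N | (j != i) && ~~ b j) w (v j + z) by exact: bigID.
  have -> : \sum_(j < N | (j != i) && (j != k)) G j =
    \sum_(j < N | ((j != i) && (j != k)) && b j) G j +
    \sum_(j < N | ((j != i) && (j != k)) && ~~ b j) G j by exact: bigID.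
  lra.
have fin j : j != i -> W (X k + z - X j) \is a fin_num.
  move=> ji; rewrite addrAC; apply: Wfin; have [bj|bj] := boolP (b j).
    by apply: zn; rewrite ji.
  rewrite -enorm_gt0; have := ler_enormD (v j + z) (- z).
  by rewrite addrK enormN; move: bj; rewrite /b -leNgt -/(v j); lra.
apply: le_trans (move_one Wm W_sym RW0 W_incr minX fin) _.
under eq_bigr do rewrite addrAC -/(v _).
apply: le_trans total _.
have e_kappa : CW * C2 * e `^ (- g) <= CW * C2 * (kappa * e1) `^ (- g).
  rewrite ler_pM2l ?mulr_gt0//; apply: ler_powRn => //; last exact: mulr_gt0.
  by rewrite oppr_le0 ltW.
have Gsum : \sum_(j < N | (j != i) && (j != k)) G j <=
    \sum_(j < N | (j != i) && (j != k)) w (v j) + N%:R * (s / 4) +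
    C3 * \sum_(j | P j) err j.
  rewrite /G !big_split/=; apply: lerD; first apply: lerD => //.
    rewrite sumr_const -[leLHS]mulr_natl ler_wpM2r ?(ltW s4)// ler_nat.
    by rewrite -[leqRHS]card_ord max_card.
  rewrite -mulr_sumr ler_pM2l// [leRHS]big_mkcond [leLHS]big_mkcond/=.
  apply: ler_sum => j _.
  by case: (P j); case: ifP => _; rewrite ?mul1r ?mul0r.
have wsum : \sum_(j < N | j != k) w (v j) =
    w (v i) + \sum_(j < N | (j != i) && (j != k)) w (v j).
  rewrite (bigD1 i) 1?eq_sym//=; congr (_ + _).
  by apply: eq_bigl => j; rewrite andbC.
have wi : - `|m| <= w (v i).
  have := fv i; rewrite eq_sym => /(_ ki); apply: le_trans.
  by have := ler_norm (- m); rewrite normrN; lra.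
have errN : C3 * \sum_(j | P j) err j <= N%:R * (s / 4).
  apply: (@le_trans _ _ (C3 * (eta * (N%:R * A)))).
    by rewrite ler_pM2l// (le_trans errF)// ler_pM2l.
  by rewrite le_eqVlt /eta; apply/predU1P; left; field; rewrite !gt_eqF.
move: Pk Ns; rewrite -/(v _) wsum /D; lra.
Qed.

Lemma diameter_bound_finite : exists K : R, 0 < K /\
  forall N (X : 'I_N -> V), (2 <= N)%N -> minimiser W X -> diameter (range X) < K.
Proof.
have sp := s0; have [N1 potential] := potential_below_limit.
have [|r [Rr rL]] := ge_limit_far Wm RW0 W_incr W_limit (A := L - s / 2).
  by rewrite WL lte_fin; lra.
apply: (diameter_bound Wm W_sym RW0 W_incr (r := r) (A := L - s / 2) (tau := s / 2)
  (N1 := N1)) => //; [exact: lt_le_trans Rr|exact: divr_gt0|].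
by move=> N X i NN minX; have := potential N X i NN minX; rewrite -!/(w _); lra.
Qed.

End finite_limit.

End potential_B.

(** * Assembly of case (B) and conclusion *)

Lemma diameter_bound_repulsive (R : realType) (n : nat)
    (W : 'rV[R]_n.+1 -> \bar R) (m RW : R) (Winf : \bar R) :
  lower_semicontinuous W -> (forall x, (m%:E <= W x)%E) ->
  (forall x, W (- x) = W x) -> Winf != -oo%E ->
  W x @[x --> enorm_infty] --> Winf ->
  0 < RW -> radially_increasing_outside W RW ->
  property_B W -> discretely_unstable W Winf ->
  exists K : R, 0 < K /\ forall N (X : 'I_N -> 'rV[R]_n.+1), (2 <= N)%N ->
    minimiser W X -> diameter (range X) < K.
Proof.
move=> lW Wm W_sym Winf_Ny W_limit RW0 W_incr
  [beta [beta2 betad [[mW _] [delta [C [delta0 C0 rep rep0]]]] C1W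
  [CW [CW0 lapW near grad]]]] unst.
(* [g] is the order of the singularity of [W], so that the gradient has order [g + 1] and the
   Laplacian [g + 2]. *)
pose g := beta - 2.
have g0 : 0 < g by rewrite /g; lra.
have gd : g < n.+1%:R by rewrite /g; lra.
have gE1 : 1 - beta = - g - 1 by rewrite /g; lra.
have gE2 : 2 - beta = - g by rewrite /g; lra.
have gE : beta = g + 2 by rewrite /g; lra.
have Wfin x : x != 0 -> W x \is a fin_num by move=> /C1W[].
have w_diff x : x != 0 -> differentiable (fine \o W) x by move=> /C1W[].
have w_cont x : x != 0 -> {for x, continuous (fine \o W)}.
  by move=> /w_diff; exact: differentiable_continuous.
have w_near x : x != 0 -> enorm x <= 1 -> fine (W x) <= CW * enorm x `^ (- g).
  move=> x0 x1; have := near x x1; rewrite /negpow (negbTE x0) gE2 -EFinM.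
  by rewrite -[W x]fineK ?Wfin.
have w_grad x : 0 < enorm x <= 1 ->
    enorm (gradient (fine \o W) x) <= CW * enorm x `^ (- g - 1).
  by rewrite -gE1; exact: grad.
have lap0 : laplacian0 W 0 = -oo%E by rewrite -[LHS]oppeK rep0.
have [W0 [r1 [c1 [C1 [r10 c10 lower]]]]] : W 0 = +oo%E /\ exists r c C1 : R,
    [/\ 0 < r, 0 < c & forall x, x != 0 -> enorm x <= r ->
    ((c * enorm x `^ (- g) - C1)%:E <= W x)%E].
  by apply: (repulsive_lower_bound mW lW Wm g0 delta0 C0) => // x /rep; rewrite gE.
have [WL|WL] := eqVneq Winf +oo%E.
  rewrite WL in W_limit; exact: (diameter_bound_infinite Wm W_sym RW0 W_incr g0 gd CW0
    Wfin w_near w_cont mW lW lapW W_limit).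
have [L {}WL] : exists L, Winf = L%:E.
  by move: Winf_Ny WL; case: (Winf) => // L _ _; exists L.
have [s [Nbar [s0 unstable]]] := unstable_potential Wm RW0 W_incr unst WL.
exact: (diameter_bound_finite Wm W_sym RW0 W_incr g0 gd CW0 Wfin w_near w_cont WL
  W_limit W0 r10 c10 lower w_diff w_grad s0 unstable).
Qed.

Theorem theorem4p12 (R : realType) (d : nat) (hd : (1 <= d)%N)
    (W : 'rV[R]_d -> \bar R)
    (W_lsc : lower_semicontinuous W)
    (W_bounded_below : exists m : R, forall x, (m%:E <= W x)%E)
    (W_loc_integrable : loc_integrable W)
    (W_symmetric : forall x, W (- x) = W x)
    (Winf : \bar R) (Winf_not_ninfty : Winf != -oo%E)
    (W_limit : W x @[x --> enorm_infty] --> Winf)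
    (W_increasing : exists RW : R, 0 < RW /\ radially_increasing_outside W RW)
    (W_AB : property_A W \/ property_B W)
    (W_unstable : discretely_unstable W Winf) :
  exists K : R, 0 < K /\
    forall (N : nat) (X : 'I_N -> 'rV[R]_d), (2 <= N)%N ->
      minimiser W X -> diameter (range X) < K.
Proof.
case: d => [//|n] in hd W W_lsc W_bounded_below W_loc_integrable W_symmetric
  W_limit W_increasing W_AB W_unstable *.
have [m Wm] := W_bounded_below; have [RW [RW0 W_incr]] := W_increasing.
case: W_AB => [[[M WM] _]|WB].
  exact: (diameter_bound_bounded Wm W_symmetric RW0 W_incr Winf_not_ninfty
    W_limit W_unstable WM).
exact: (diameter_bound_repulsive W_lsc Wm W_symmetric Winf_not_ninfty W_limit
  RW0 W_incr WB W_unstable).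
Qed.
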